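(* Let $a \ge 0$ and $\Phi \in \mathcal{B}_a(\Lambda)$. Then the dynamics $\{\tau_t\}_{t\in\mathbb{R}}$ corresponding to $\Phi$ exists as a strongly continuous one-parameter group of automorphisms of $\mathcal{A}$. In particular, for every increasing sequence $\{\Lambda_n\}$ of finite subsets of $\Lambda$ exhausting $\Lambda$ and every $A \in \mathcal{A}$, $$\lim_{n\to\infty} \| \tau_t^{\Lambda_n}(A) - \tau_t(A) \| = 0 \quad \text{for all } t \in \mathbb{R}.$$ The convergence is uniform for $t$ in compact sets, and the limit is independent of the choice of the exhausting sequence $\{\Lambda_n\}$.
   Context: $\Lambda$ is a (possibly infinite) set equipped with a metric $d$. To each $x \in \Lambda$ is assigned a finite-dimensional Hilbert space $\mathcal{H}_x$. For finite $X \subset \Lambda$, $\mathcal{H}_X = \bigotimes_{x\in X} \mathcal{H}_x$ and $\mathcal{A}_X = \mathcal{B}(\mathcal{H}_X)$ (bounded linear operators) is the algebra of observables supported in $X$. For $X_1 \subset X_2$, $\mathcal{A}_{X_1}$ is embedded in $\mathcal{A}_{X_2}$ by tensoring with the identity, and $\mathcal{A}$ is the $C^*$-algebra obtained as the norm completion of $\bigcup_{X \text{ finite}} \mathcal{A}_X$. An interaction is a map $\Phi$ assigning to each finite $X \subset \Lambda$ a self-adjoint element $\Phi(X) = \Phi(X)^* \in \mathcal{A}_X$. For a finite set $\Lambda_n \subset \Lambda$, the finite-volume dynamics is $\tau_t^{\Lambda_n}(A) = e^{itH_{\Lambda_n}} A e^{-itH_{\Lambda_n}}$ for $A \in \mathcal{A}$,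 where $H_{\Lambda_n} = \sum_{X \subset \Lambda_n} \Phi(X)$. The dynamics $\tau_t$ corresponding to $\Phi$ means the limit of the finite-volume dynamics. Strongly continuous means that $t \mapsto \tau_t(A)$ is norm continuous for every $A \in \mathcal{A}$. Standing assumption: there is a fixed non-increasing function $F : [0,\infty) \to (0,\infty)$ such that (i) $\sup_{x\in\Lambda} \sum_{y \in \Lambda} F(d(x,y)) < \infty$, and (ii) $\sup_{x,y\in\Lambda} \sum_{z\in\Lambda} \frac{F(d(x,z)) F(d(z,y))}{F(d(x,y))} < \infty$. For $a \ge 0$ put $F_a(r) := e^{-ar} F(r)$. $\mathcal{B}_a(\Lambda)$ is the set of interactions $\Phi$ with $$\|\Phi\|_a := \sup_{x,y\in\Lambda} \sum_{X \ni x,y} \frac{\|\Phi(X)\|}{F_a(d(x,y))} < \infty,$$ the sum being over finite $X \subset \Lambda$ containing $x$ and $y$. *)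

(* Defs.v *)
From HB Require Import structures.
From mathcomp Require Import all_boot all_order all_algebra.
From mathcomp Require Import finmap complex.
From mathcomp Require Import all_classical all_reals all_analysis.

Set Implicit Arguments.
Unset Strict Implicit.
Unset Printing Implicit Defensive.

Import Order.TTheory GRing.Theory Num.Theory.
Import numFieldNormedType.Exports.

Local Open Scope classical_set_scope.
Local Open Scope fset_scope.
Local Open Scope ring_scope.
Local Open Scope sesquilinear_scope.

(** * Unital C*-algebras

    The product is a field of the mixin rather than a ring structure of the
    library, because the library has no structure between rings and normed
    Z-modules on the one hand and [numDomainType] on the other. *)

HB.mixin Record isCStarAlgebra (C : numClosedFieldType) A
    & CompleteNormedModule C A := {
  cmul : A -> A -> A ;
  cone : A ;
  star : A -> A ;
  cmulA : associative cmul ;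
  cmul1x : left_id cone cmul ;
  cmulx1 : right_id cone cmul ;
  cmulDl : left_distributive cmul +%R ;
  cmulDr : right_distributive cmul +%R ;
  cmulZl : forall (c : C) x y, cmul (c *: x) y = c *: cmul x y ;
  cmulZr : forall (c : C) x y, cmul x (c *: y) = c *: cmul x y ;
  starD : forall x y, star (x + y) = star x + star y ;
  starZ : forall (c : C) x, star (c *: x) = c^* *: star x ;
  starM : forall x y, star (cmul x y) = cmul (star y) (star x) ;
  starK : involutive star ;
  cnormM : forall x y : A, `|cmul x y| <= `|x| * `|y| ;
  cnorm_star : forall x : A, `|cmul (star x) x| = `|x| ^+ 2
}.

#[short(type="cstarAlgType")]
HB.structure Definition CStarAlgebra (C : numClosedFieldType) :=
  {A of CompleteNormedModule C A & isCStarAlgebra C A}.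

Section CStarAlgebraNotions.
Context {R : realType} {A : cstarAlgType R[i]}.

Definition cpow (x : A) (n : nat) : A := iter n (cmul x) cone.

Definition cexp (x : A) : A :=
  limn (series (fun n => (n`!%:R : R[i])^-1 *: cpow x n)).

Definition star_automorphism (f : A -> A) : Prop :=
  [/\ linear f, {morph f : x y / cmul x y}, {morph f : x / star x}
    & bijective f].

Definition automorphism_group (tau : R -> A -> A) : Prop :=
  [/\ forall t, star_automorphism (tau t),
      forall x, tau 0 x = x
    & forall s t x, tau (s + t) x = tau s (tau t x)].

Definition strongly_continuous (tau : R -> A -> A) : Prop :=
  forall x : A, continuous (fun t : R => tau t x).

End CStarAlgebraNotions.

(** * Local observables

    Each finite-dimensional Hilbert space [H_x] is presented by an orthonormal
    basis, as [C^(dim x)].  Then the tensor product [H_X] of the [H_x], x in X,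
    is l^2 of the finite set [config X] of families of basis indices, and
    [B(H_X)] is the algebra of matrices whose rows and columns are enumerated by
    [config X]. *)

Section LocalObservables.
Context {R : realType} {L : choiceType} (dim : L -> nat).

Definition config (X : {fset L}) : finType :=
  {dffun forall x : X, 'I_(dim (val x))}.

Definition observable (X : {fset L}) : Type := 'M[R[i]]_#|config X|.

Definition config_restr (X Y : {fset L}) (XY : X `<=` Y) (s : config Y) :
  config X := [ffun x : X => s (fincl XY x)].

Definition agree_off (X Y : {fset L}) (s t : config Y) : bool :=
  [forall y : Y, (val y \notin X) ==> (s y == t y)].

(* The matrix of [a (x) 1] on [H_Y = H_X (x) H_(Y \ X)]. *)
Definition ampl (X Y : {fset L}) (XY : X `<=` Y) (a : observable X) :
    observable Y :=
  \matrix_(i, j)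
    let s : config Y := enum_val i in
    let t : config Y := enum_val j in
    if agree_off X s t
    then a (enum_rank (config_restr XY s)) (enum_rank (config_restr XY t))
    else 0.

End LocalObservables.

Section OperatorNorm.
Context {R : realType} {n : nat}.

Definition l2norm (v : 'cV[R[i]]_n) : R :=
  Num.sqrt (\sum_i (complex.Re (v i 0) ^+ 2 + complex.Im (v i 0) ^+ 2)).

Definition opnorm (a : 'M[R[i]]_n) : R :=
  sup [set l2norm (a *m v) | v in [set v : 'cV[R[i]]_n | l2norm v <= 1]].

End OperatorNorm.

(** * The quasi-local algebra

    A norm completion of the union of the local algebras: a C*-algebra with
    isometric unital *-embeddings of the local algebras, compatible with the
    inclusions [a |-> a (x) 1], whose ranges have dense union.  These properties
    determine it up to a unique isometric *-isomorphism. *)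

Section QuasiLocal.
Context {R : realType} {L : choiceType} (dim : L -> nat).
Variables (A : cstarAlgType R[i]).
Variable iota : forall X : {fset L}, @observable R L dim X -> A.

Record quasilocal_algebra : Prop := QuasilocalAlgebra {
  iota_linear : forall X (c : R[i]) (a b : 'M[R[i]]_#|config dim X|),
    iota (c *: a + b : observable dim X) = c *: iota a + iota b ;
  iota1 : forall X, iota (1%:M : observable dim X) = cone ;
  iotaM : forall X (a b : observable dim X),
    iota (a *m b : observable dim X) = cmul (iota a) (iota b) ;
  iota_star : forall X (a : observable dim X),
    iota (a ^t* : observable dim X) = star (iota a) ;
  iota_isometry : forall X (a : observable dim X),
    `|iota a| = (opnorm a)%:C%C ;
  iota_ampl : forall (X Y : {fset L}) (XY : X `<=` Y) (a : observable dim X),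
    iota (ampl XY a) = iota a ;
  iota_dense : dense (\bigcup_(X in [set: {fset L}]) range (@iota X))
}.

End QuasiLocal.

(** * Interactions and finite-volume dynamics *)

Record interaction (R : realType) (L : choiceType) (dim : L -> nat) :=
  Interaction {
    interaction_term :> forall X : {fset L}, @observable R L dim X ;
    interaction_sa : forall X, (interaction_term X) ^t* = interaction_term X
  }.

Section Dynamics.
Context {R : realType} {L : choiceType} (dim : L -> nat).
Context {A : cstarAlgType R[i]}.
Variable iota : forall X : {fset L}, @observable R L dim X -> A.
Variable Phi : interaction R dim.

Definition hamiltonian (V : {fset L}) : A :=
  \sum_(X <- fpowerset V) iota (Phi X).

Definition finite_volume_dynamics (V : {fset L}) (t : R) (x : A) : A :=
  let H := hamiltonian V in
  cmul (cmul (cexp (('i * t%:C)%C *: H)) x) (cexp ((- ('i * t%:C))%C *: H)).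

End Dynamics.

Definition exhausting (L : choiceType) (V : nat -> {fset L}) : Prop :=
  (forall m n, (m <= n)%N -> V m `<=` V n) /\
  (forall x, exists n, x \in V n).

(** * Decay functions and the classes B_a *)

Section Decay.
Context {R : realType} {L : metricType R}.
Local Open Scope ereal_scope.

(* Only the values of [F] on [0, +oo[ matter. *)
Record decay_function (F : R -> R) : Prop := DecayFunction {
  decay_gt0 : forall r : R, (0 <= r)%R -> (0 < F r)%R ;
  decay_noninc : forall r s : R, (0 <= r)%R -> (r <= s)%R -> (F s <= F r)%R ;
  decay_summable :
    ereal_sup [set \esum_(y in [set: L]) (F (mdist x y))%:E | x in [set: L]]
      < +oo ;
  decay_convolution :
    ereal_sup [set \esum_(z in [set: L])
                     (F (mdist p.1 z) * F (mdist z p.2) / F (mdist p.1 p.2))%:E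
              | p in [set: L * L]] < +oo
}.

Definition weighted (F : R -> R) (a : R) (r : R) : R := (expR (- a * r) * F r)%R.

Definition interaction_norm (dim : L -> nat) (F : R -> R) (a : R)
    (Phi : interaction R dim) : \bar R :=
  ereal_sup [set \esum_(X in [set X : {fset L} | p.1 \in X /\ p.2 \in X])
                   (opnorm (Phi X) / weighted F a (mdist p.1 p.2))%:E
            | p in [set: L * L]].

Definition interaction_class (dim : L -> nat) (F : R -> R) (a : R) :
    set (interaction R dim) :=
  [set Phi | interaction_norm F a Phi < +oo].

End Decay.

Arguments decay_function {R} L F.

(* Main.v *)
Require Import Defs.
From HB Require Import structures.
From mathcomp Require Import all_boot all_order all_algebra.
From mathcomp Require Import finmap complex.
From mathcomp Require Import all_classical all_reals all_analysis.
From mathcomp Require Import ring lra.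

(** Write H_V for the Hamiltonian of a finite volume V.  For V in W, Duhamel's
    formula bounds the difference of the two finite-volume evolutions of a local
    observable x by the integral over s of |[H_W - H_V, tau^V_s(x)]|.  A
    Lieb-Robinson argument controls this commutator: if |[B, x]| is at most
    |x| times the sum of w(y) over y in Y for all x supported in Y, then
    |[B, tau^V_s(x)]| is at most |x| times the sum over y in Y of
    w(y) + e^(beta s) * (sum over z in V of F(d(y,z)) w(z)),
    the convolution condition on F making the last expression a supersolution.
    For B = H_W - H_V one can take w(y) to be twice the sum of |Phi(X)| over the
    X containing y that meet the complement of V; it is bounded and tends to 0
    as V grows, so summability of F makes the bound small.  Hence the
    finite-volume evolutions are Cauchy on local observables, and by isometry
    and density on all of A.  Both integral estimates are obtained as limits of
    time discretizations, from the expansion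
    tau_h(x) = x + i h [H, x] + O(h^2) of the finite-volume dynamics. *)

Set Implicit Arguments.
Unset Strict Implicit.
Unset Printing Implicit Defensive.

Import Order.TTheory GRing.Theory Num.Theory.
Import numFieldNormedType.Exports.

Local Open Scope classical_set_scope.
Local Open Scope ring_scope.

(** * C*-algebras as rings with a real-valued norm *)

(* A copy of a C*-algebra that carries the ring structure which [cstarAlgType]
   leaves out. *)
Definition calg (C : numClosedFieldType) (A : cstarAlgType C) : Type := A.

Section CalgRing.
Context {C : numClosedFieldType} (A : cstarAlgType C).

HB.instance Definition _ := CompleteNormedModule.copy (calg A) A.

HB.instance Definition _ := GRing.Zmodule_isPzRing.Build (calg A)
  (@cmulA C A) (@cmul1x C A) (@cmulx1 C A) (@cmulDl C A) (@cmulDr C A).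

Lemma calgZl (c : C) (x y : calg A) : (c *: x) * y = c *: (x * y).
Proof. exact: cmulZl. Qed.

Lemma calgZr (c : C) (x y : calg A) : x * (c *: y) = c *: (x * y).
Proof. exact: cmulZr. Qed.

End CalgRing.

Section RealNorm.
Context {R : realType} {A : cstarAlgType R[i]}.
Implicit Types (x y u : calg A).

(** The norm itself takes values in [R[i]]; by [nrmE] its real part loses nothing, and estimates
    become ordinary real inequalities. *)
Definition nrm x : R := complex.Re `|x|.

Definition dag x : calg A := star (x : A).

Lemma nrmE x : `|x| = (nrm x)%:C%C.
Proof. by rewrite RRe_real// ger0_real. Qed.

Lemma nrm_ge0 x : 0 <= nrm x.
Proof. by rewrite -ler0c -nrmE. Qed.

Lemma nrm0 : nrm 0 = 0.
Proof. by rewrite /nrm normr0. Qed.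

Lemma nrm_eq0 x : nrm x = 0 -> x = 0.
Proof. by move=> x0; apply/normr0_eq0; rewrite nrmE x0. Qed.

Lemma nrmD x y : nrm (x + y) <= nrm x + nrm y.
Proof. by rewrite -lecR rmorphD /= -!nrmE ler_normD. Qed.

Lemma nrmN x : nrm (- x) = nrm x.
Proof. by rewrite /nrm normrN. Qed.

Lemma nrmB x y : nrm (x - y) <= nrm x + nrm y.
Proof. by rewrite -[nrm y]nrmN nrmD. Qed.

Lemma nrmBC x y : nrm (x - y) = nrm (y - x).
Proof. by rewrite /nrm distrC. Qed.

Lemma nrm_tri y x z : nrm (x - z) <= nrm (x - y) + nrm (y - z).
Proof. by rewrite -(subrKA y x (- z)) nrmD. Qed.

Lemma nrmM x y : nrm (x * y) <= nrm x * nrm y.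
Proof. by rewrite -lecR rmorphM /= -!nrmE; exact: cnormM. Qed.

Lemma nrmZ (c : R[i]) x : nrm (c *: x) = complex.Re `|c| * nrm x.
Proof.
apply: complexI; rewrite rmorphM /= -!nrmE normrZ.
by congr (_ * _); rewrite RRe_real ?ger0_real.
Qed.

Lemma nrmZr (c : R) x : nrm (c%:C%C *: x) = `|c| * nrm x.
Proof. by rewrite nrmZ normc_def /= expr0n addr0 sqrtr_sqr. Qed.

Lemma nrmZi (c : R) x : nrm (('i * c%:C)%C *: x) = `|c| * nrm x.
Proof.
rewrite nrmZ normc_def /=; simpc.
by rewrite /= expr0n add0r sqrtr_sqr.
Qed.

Lemma nrm_sum (I : Type) (r : seq I) (P : pred I) (f : I -> calg A) :
  nrm (\sum_(i <- r | P i) f i) <= \sum_(i <- r | P i) nrm (f i).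
Proof.
elim/big_ind2: _ => [|x1 x2 y1 y2 h1 h2|//]; first by rewrite nrm0.
exact/(le_trans (nrmD _ _))/lerD.
Qed.

Lemma dagM x y : dag (x * y) = dag y * dag x.
Proof. exact: starM. Qed.

Lemma dagD x y : dag (x + y) = dag x + dag y.
Proof. exact: starD. Qed.

Lemma dagZ c x : dag (c *: x) = c^* *: dag x.
Proof. exact: starZ. Qed.

Lemma dagK : involutive dag.
Proof. exact: starK. Qed.

Lemma dag0 : dag 0 = 0.
Proof. by rewrite -[0](scale0r (0 : calg A)) dagZ conjC0 !scale0r. Qed.

Lemma dagN x : dag (- x) = - dag x.
Proof. by apply/eqP; rewrite -addr_eq0 -dagD addNr dag0. Qed.

Lemma dagB x y : dag (x - y) = dag x - dag y.
Proof. by rewrite dagD dagN. Qed.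

Lemma dag1 : dag 1 = 1.
Proof. by rewrite -[LHS]mulr1 -{2}[1]dagK -dagM mulr1 dagK. Qed.

Lemma dagX x n : dag (x ^+ n) = dag x ^+ n.
Proof.
by elim: n => [|n IH]; rewrite ?expr0 ?dag1// exprSr dagM IH -exprS.
Qed.

Lemma dag_sum (I : Type) (r : seq I) (P : pred I) (f : I -> calg A) :
  dag (\sum_(i <- r | P i) f i) = \sum_(i <- r | P i) dag (f i).
Proof. exact: (big_morph dag dagD dag0). Qed.

Lemma nrm_dagM x : nrm (dag x * x) = nrm x ^+ 2.
Proof.
apply: complexI; rewrite -nrmE rmorphXn /= -nrmE; exact: cnorm_star.
Qed.

(** The C*-identity gives |y|^2 <= |y*| |y|. Cancelling |y| and using the result for both x and x*
    gives equality. *)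
Lemma nrm_dag x : nrm (dag x) = nrm x.
Proof.
have le_dag y : nrm y <= nrm (dag y).
  have [->|y0] := eqVneq (nrm y) 0; first exact: nrm_ge0.
  have y_gt0 : 0 < nrm y by rewrite lt_neqAle eq_sym y0 nrm_ge0.
  by rewrite -(ler_pM2r y_gt0) -expr2 -nrm_dagM nrmM.
by apply/eqP; rewrite eq_le le_dag -{2}[x]dagK le_dag.
Qed.

(** By the C*-identity |1| is its own square; the inequality also covers the zero algebra, where |1|
    = 0. *)
Lemma nrm1_le : nrm 1 <= 1.
Proof.
have [//|lt1] := lerP (nrm 1) 1.
have : nrm 1 ^+ 2 = nrm 1 by rewrite -nrm_dagM dag1 mulr1.
by move=> h; nra.
Qed.

Lemma nrmX x n : nrm (x ^+ n) <= nrm x ^+ n.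
Proof.
elim: n => [|n IH]; first by rewrite !expr0 nrm1_le.
by rewrite exprS [leRHS]exprS (le_trans (nrmM _ _))// ler_wpM2l ?nrm_ge0.
Qed.

Lemma nrm_unitary u : dag u * u = 1 -> nrm u <= 1.
Proof.
move=> h; have := nrm1_le; rewrite -h nrm_dagM => h1.
by rewrite -(@ler_pXn2r _ 2)// ?nnegrE ?nrm_ge0// expr1n.
Qed.

(** Unitaries have norm at most 1, so conjugation by u and its inverse, conjugation by u*, are both
    contractions. *)
Lemma nrm_conj u x : dag u * u = 1 -> u * dag u = 1 ->
  nrm (u * x * dag u) = nrm x.
Proof.
move=> h1 h2.
have le_conj v y : dag v * v = 1 -> nrm (v * y * dag v) <= nrm y.
  move=> hv; have := nrm_unitary hv => v1.
  apply: (le_trans (nrmM _ _)); rewrite nrm_dag.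
  apply: (@le_trans _ _ (nrm (v * y))); first by rewrite ler_piMr// nrm_ge0.
  apply: (le_trans (nrmM _ _)); by rewrite ler_piMl// nrm_ge0.
apply/eqP; rewrite eq_le le_conj//=.
have {1}-> : x = dag u * (u * x * dag u) * dag (dag u).
  by rewrite dagK !mulrA h1 mul1r -mulrA h1 mulr1.
by apply: le_conj; rewrite dagK.
Qed.

(** * Commutators *)

Definition comm x y : calg A := x * y - y * x.

Lemma commDl x y z : comm (x + y) z = comm x z + comm y z.
Proof. by rewrite /comm mulrDl mulrDr opprD addrACA. Qed.

Lemma commDr x y z : comm x (y + z) = comm x y + comm x z.
Proof. by rewrite /comm mulrDl mulrDr opprD addrACA. Qed.

Lemma commZl c x y : comm (c *: x) y = c *: comm x y.
Proof. by rewrite /comm calgZl calgZr scalerBr. Qed.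

Lemma commZr c x y : comm x (c *: y) = c *: comm x y.
Proof. by rewrite /comm calgZl calgZr scalerBr. Qed.

Lemma comm_suml (I : Type) (r : seq I) (P : pred I) (f : I -> calg A) y :
  comm (\sum_(i <- r | P i) f i) y = \sum_(i <- r | P i) comm (f i) y.
Proof. by rewrite /comm mulr_suml mulr_sumr sumrB. Qed.

Lemma comm_sumr (I : Type) (r : seq I) (P : pred I) (f : I -> calg A) y :
  comm y (\sum_(i <- r | P i) f i) = \sum_(i <- r | P i) comm y (f i).
Proof. by rewrite /comm mulr_suml mulr_sumr sumrB. Qed.

Lemma nrm_comm x y : nrm (comm x y) <= 2 * (nrm x * nrm y).
Proof.
rewrite (le_trans (nrmB _ _))// mulrDl mul1r lerD ?nrmM//.
by rewrite (le_trans (nrmM _ _))// mulrC.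
Qed.

(** The Jacobi identity, arranged for the Lieb-Robinson step: for self-adjoint h the first summand
    generates a norm-preserving evolution of [b, x], and the second acts as a source term. *)
Lemma comm_jacobi b h x :
  comm b (comm h x) = comm h (comm b x) + comm (comm b h) x.
Proof.
rewrite /comm !mulrBl !mulrBr !mulrA !opprB.
by rewrite !addrA [RHS](AC 8 ((5*4*7*2)*(1*6)*(3*8))) /= !subrr !addr0.
Qed.

End RealNorm.

(** * The exponential *)

Section ExpProduct.
Variables (T : pzRingType) (c : nat -> T).
Hypothesis c_fact : forall k, c k * k`!%:R = 1.
Hypothesis c_central : forall k x, GRing.comm x (c k).

(** There is no division in [T]: one multiplies by [e1], which exhibits the right-hand side as an
    inverse of i! (k - i)!. *)
Lemma fact_coeff_bin k i : (i <= k)%N -> c k * 'C(k, i)%:R = c (k - i)%N * c i.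
Proof.
move=> ik.
have e1 : (i`! * (k - i)`!)%:R * (c (k - i)%N * c i) = 1.
  rewrite mulnC natrM -mulrA [i`!%:R * _]mulrA (c_central _ i`!%:R).
  by rewrite -mulrA (c_central _ i`!%:R) c_fact mulr1 c_central c_fact.
rewrite -[LHS]mulr1 -[X in _ * X]e1 mulrA -[X in X * _]mulrA -natrM bin_fact//.
by rewrite c_fact mul1r.
Qed.

Lemma sum_antidiagonal (f : nat -> nat -> T) n :
  \sum_(0 <= k < n) \sum_(i < k.+1) f (k - i)%N i =
  \sum_(0 <= i < n) \sum_(0 <= j < n - i) f j i.
Proof.
elim: n => [|n IH]; first by rewrite !big_geq.
rewrite !big_nat_recr//= IH subSnn big_nat1 big_ord_recr/= subnn addrA.
congr (_ + _); rewrite -(big_mkord xpredT (fun i => f (n - i)%N i)) -big_split/=.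
apply: eq_big_nat => i /andP[_ lt_in].
by rewrite subSn ?(ltnW lt_in)// big_nat_recr.
Qed.

(** The monomials of total degree below n cancel, leaving the corner i + j >= n of the square. The
    coefficients are abstract so that the identity serves both in the algebra and for the real
    majorant. *)
Lemma exp_sum_product n x y : GRing.comm x y ->
  (\sum_(0 <= i < n) c i * x ^+ i) * (\sum_(0 <= i < n) c i * y ^+ i)
    - \sum_(0 <= i < n) c i * (x + y) ^+ i =
  \sum_(0 <= i < n) \sum_(n - i <= j < n) c j * c i * (x ^+ j * y ^+ i).
Proof.
move=> xy.
have -> : \sum_(0 <= k < n) c k * (x + y) ^+ k =
    \sum_(0 <= i < n) \sum_(0 <= j < n - i) c j * c i * (x ^+ j * y ^+ i).
  rewrite -sum_antidiagonal; apply: eq_bigr => k _.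
  rewrite exprDn_comm// mulr_sumr; apply: eq_bigr => i _.
  by rewrite -mulr_natl mulrA fact_coeff_bin // -ltnS.
rewrite mulr_sumr -sumrB; apply: eq_big_nat => i /andP[_ lt_in].
rewrite mulr_suml [X in X - _](@big_cat_nat _ _ _ (n - i)) ?leq_subr//=.
rewrite addrAC -sumrB big1 ?add0r => [|j _]; last first.
  by rewrite -!mulrA [x ^+ j * _]mulrA c_central -!mulrA subrr.
by apply: eq_bigr => j _; rewrite -!mulrA [x ^+ j * _]mulrA c_central -!mulrA.
Qed.

End ExpProduct.

(** * The real exponential as a majorant *)

Section RealExp.
Context {R : realType}.
Implicit Types r s : R.

Definition exp_psum r n := \sum_(0 <= k < n) (k`!%:R)^-1 * r ^+ k.

Lemma exp_psumE r : exp_psum r = series (exp_coeff r).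
Proof.
by rewrite funeqE => n; apply: eq_bigr => k _; rewrite /exp_coeff mulrC.
Qed.

Lemma cvg_exp_psum r : exp_psum r @ \oo --> expR r.
Proof. by rewrite exp_psumE; exact: is_cvg_series_exp_coeff. Qed.

Lemma exp_psum_homo r : 0 <= r -> {homo exp_psum r : m n / (m <= n)%N >-> m <= n}.
Proof.
move=> r0 m n mn; rewrite /exp_psum [leRHS](@big_cat_nat _ _ _ m)//= lerDl.
by apply: sumr_ge0 => k _; rewrite mulr_ge0 ?exprn_ge0.
Qed.

Lemma exp_psum_le r n : 0 <= r -> exp_psum r n <= expR r.
Proof.
move=> r0; rewrite -(cvg_lim _ (@cvg_exp_psum r))//.
apply: nondecreasing_cvgn_le; first exact: exp_psum_homo.
by apply/cvg_ex; exists (expR r); exact: (@cvg_exp_psum r).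
Qed.

End RealExp.

(** * Norm limits of sequences *)

Section NrmLimits.
Context {R : realType} {A : cstarAlgType R[i]}.

Definition ncvg (u : nat -> calg A) (l : calg A) :=
  forall e : R, 0 < e -> exists N, forall n, (N <= n)%N -> nrm (u n - l) < e.

Lemma Re_gt0 (e : R[i]) : 0 < e -> 0 < complex.Re e /\ e = (complex.Re e)%:C%C.
Proof.
move=> e0; have e1 : e = (complex.Re e)%:C%C by rewrite RRe_real// gtr0_real.
by split => //; rewrite -ltcR -e1.
Qed.

Lemma ncvgP (u : nat -> calg A) l : ncvg u l <-> u @ \oo --> l.
Proof.
split.
  move=> h; apply/cvgrPdist_lt => e /Re_gt0[e0 ->].
  have [N hN] := h _ e0; exists N => // n /= Nn.
  by rewrite distrC nrmE ltcR hN.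
move=> /cvgrPdist_lt h e e0.
have [|N _ hN] := h e%:C%C; first by rewrite ltcR.
by exists N => n /hN /=; rewrite distrC nrmE ltcR.
Qed.

Lemma ncauchy_cvg (u : nat -> calg A) :
  (forall e : R, 0 < e -> exists N, forall n m, (N <= n)%N -> (N <= m)%N ->
     nrm (u n - u m) < e) -> ncvg u (limn u).
Proof.
move=> h; apply/ncvgP.
have : cauchy (u @ \oo).
  apply/cauchyP => e /Re_gt0[e0 e1].
  have [N hN] := h _ e0; exists (u N); exists N => // n /= Nn.
  by rewrite -ball_normE /= nrmE e1 ltcR hN.
by move/cauchy_cvgP.
Qed.

Lemma ncvg_unique (u : nat -> calg A) l l' : ncvg u l -> ncvg u l' -> l = l'.
Proof.
by move=> /ncvgP h /ncvgP; apply: cvg_unique.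
Qed.

Lemma ncvg_eventually (u v : nat -> calg A) l :
  (forall e : R, 0 < e -> exists N, forall n, (N <= n)%N -> nrm (u n - v n) < e) ->
  ncvg v l -> ncvg u l.
Proof.
move=> h hv e e0; have e20 : 0 < e / 2 by rewrite divr_gt0.
have [N hN] := h _ e20; have [M hM] := hv _ e20.
exists (maxn N M) => n; rewrite geq_max => /andP[Nn Mn].
rewrite (le_lt_trans (nrm_tri (v n) _ _))// [e]splitr ltrD ?hN ?hM//.
Qed.

Lemma ncvg_cst l : ncvg (fun=> l) l.
Proof. by move=> e e0; exists 0%N => n _; rewrite subrr nrm0. Qed.

Lemma ncvgD u v l m : ncvg u l -> ncvg v m -> ncvg (fun n => u n + v n) (l + m).
Proof. by move=> /ncvgP hu /ncvgP hv; apply/ncvgP; exact: cvgD. Qed.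

Lemma ncvgZ c u l : ncvg u l -> ncvg (fun n => c *: u n) (c *: l).
Proof. by move=> /ncvgP hu; apply/ncvgP; exact: cvgZr. Qed.

Lemma ncvg_dag u l : ncvg u l -> ncvg (fun n => dag (u n)) (dag l).
Proof.
move=> h e /h[N hN]; exists N => n /hN; by rewrite -dagB nrm_dag.
Qed.

Lemma ncvg_le u l (r : R) : ncvg u l -> (forall n, nrm (u n) <= r) -> nrm l <= r.
Proof.
move=> h hr; apply/ler_addgt0Pr => e /h[N /(_ N (leqnn N)) hN].
rewrite -[l](subrK (u N)) addrC (le_trans (nrmD _ _))// lerD//.
by rewrite nrmBC ltW.
Qed.

Lemma ncvgM u v l m : ncvg u l -> ncvg v m -> ncvg (fun n => u n * v n) (l * m).
Proof.
move=> hu hv e e0.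
pose K := nrm l + nrm m + 1.
have K0 : 0 < K by rewrite ltr_wpDl// addr_ge0 ?nrm_ge0.
have D0 : 0 < 2 * K + e by lra.
(* This gives both d < 1 and d * K < e. As d < 1, the product of the two errors is at most d, which
   the summand 1 of [K] accounts for. *)
pose d := e / (2 * K + e).
have d0 : 0 < d by rewrite divr_gt0.
have d1 : d < 1 by rewrite ltr_pdivrMr// mul1r; lra.
have de : d * K < e by rewrite mulrAC ltr_pdivrMr//; nra.
have [N hN] := hu _ d0; have [M hM] := hv _ d0.
exists (maxn N M) => n; rewrite geq_max => /andP[/hN un /hM vn].
have -> : u n * v n - l * m =
    (u n - l) * (v n - m) + (u n - l) * m + l * (v n - m).
  by rewrite -mulrDr subrK mulrBl mulrBr addrA subrK.
apply: le_lt_trans de; apply: (le_trans (nrmD _ _)).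
have hl := le_trans (nrmM l (v n - m)) (ler_wpM2l (nrm_ge0 l) (ltW vn)).
have hm := le_trans (nrmM (u n - l) m) (ler_wpM2r (nrm_ge0 m) (ltW un)).
have h1 : nrm ((u n - l) * (v n - m)) <= d.
  apply: (le_trans (nrmM _ _)); rewrite -[d]mulr1.
  by rewrite ler_pM ?nrm_ge0 ?(ltW un)// ltW// (lt_trans vn).
apply: (le_trans (lerD (nrmD _ _) (lexx _))).
by apply: (le_trans (lerD (lerD h1 hm) hl)); rewrite /K; lra.
Qed.

End NrmLimits.

(** * The exponential in the algebra *)

Section Exponential.
Context {R : realType} {A : cstarAlgType R[i]}.
Implicit Types (x y : calg A) (r : R).

Definition nexp x : calg A := cexp (x : A).

Definition exp_term x k : calg A := (k`!%:R : R[i])^-1 *: x ^+ k.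

Lemma cpowE x k : cpow (x : A) k = x ^+ k.
Proof. by elim: k => [|k IH]; rewrite ?expr0// exprS -IH. Qed.

Lemma nrm_exp_term x k : nrm (exp_term x k) <= (k`!%:R)^-1 * nrm x ^+ k.
Proof.
have -> : exp_term x k = ((k`!%:R : R)^-1)%:C%C *: x ^+ k.
  by rewrite /exp_term fmorphV rmorph_nat.
by rewrite nrmZr ger0_norm// ler_wpM2l// nrmX.
Qed.

Lemma nrm_exp_terms x m n : nrm (\sum_(m <= k < n) exp_term x k) <=
  \sum_(m <= k < n) (k`!%:R)^-1 * nrm x ^+ k.
Proof.
by apply: (le_trans (nrm_sum _ _ _)); apply: ler_sum => k _; exact: nrm_exp_term.
Qed.

(** After shifting the index by p, (k + p)! >= k! bounds each term by r^p times a term of the full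
    series. *)
Lemma real_exp_tail r p n : 0 <= r ->
  \sum_(p <= k < n) (k`!%:R)^-1 * r ^+ k <= r ^+ p * expR r.
Proof.
move=> r0; rewrite -[p]add0n big_addn.
apply: (@le_trans _ _ (r ^+ p * exp_psum r (n - p))); last first.
  by rewrite add0n ler_wpM2l ?exprn_ge0// exp_psum_le.
rewrite /exp_psum mulr_sumr; apply: ler_sum => k _.
rewrite exprD mulrA mulrC ler_wpM2l ?exprn_ge0// ler_wpM2r ?exprn_ge0//.
rewrite lef_pV2 ?posrE ?ltr0n ?fact_gt0// ler_nat.
by apply: leq_fact; exact: leq_addr.
Qed.

Lemma nexp_cvg x : ncvg (fun n => \sum_(0 <= k < n) exp_term x k) (nexp x).
Proof.
have -> : nexp x = limn (fun n => \sum_(0 <= k < n) exp_term x k).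
  rewrite /nexp /cexp; congr (lim (_ @ \oo)); apply/funext => n.
  by rewrite /series /=; apply: eq_bigr => k _; rewrite cpowE.
apply: ncauchy_cvg => e e0.
have /cvgrPdist_lt/(_ (e / 2)) := @cvg_exp_psum R (nrm x).
rewrite divr_gt0// => /(_ isT)[N _ hN].
have wlog_le m n : (N <= m)%N -> (m <= n)%N ->
    nrm (\sum_(0 <= k < n) exp_term x k - \sum_(0 <= k < m) exp_term x k) < e.
  move=> Nm mn; rewrite (@big_cat_nat _ _ _ m)//= addrAC subrr add0r.
  apply: (le_lt_trans (nrm_exp_terms _ _ _)).
  have -> : \sum_(m <= k < n) (k`!%:R)^-1 * nrm x ^+ k =
     exp_psum (nrm x) n - exp_psum (nrm x) m.
    by rewrite /exp_psum [in RHS](@big_cat_nat _ _ _ m 0 n)//= addrAC subrr add0r.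
  have := hN _ Nm; have := hN _ (leq_trans Nm mn); rewrite /= !ltr_norml.
  by move=> /andP[? ?] /andP[? ?]; lra.
exists N => n m Nn Nm.
have [mn|/ltnW nm] := leqP m n; first exact: wlog_le.
by rewrite nrmBC; exact: wlog_le.
Qed.

(** The cases p = 1 and p = 2 give the remainders used in [dyn_expansion]. *)
Lemma nexp_tail x p :
  nrm (nexp x - \sum_(0 <= k < p) exp_term x k) <= nrm x ^+ p * expR (nrm x).
Proof.
have h : ncvg (fun n => \sum_(p <= k < n) exp_term x k)
    (nexp x - \sum_(0 <= k < p) exp_term x k).
  move=> e /(nexp_cvg x)[N hN]; exists (maxn N p) => n.
  rewrite geq_max => /andP[Nn pn].
  rewrite opprB addrA [X in nrm (X - _)]addrC -(@big_cat_nat _ _ _ p)//; exact: hN.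
apply: (ncvg_le h) => n.
exact: (le_trans (nrm_exp_terms _ _ _) (real_exp_tail _ _ (nrm_ge0 _))).
Qed.

Lemma nrm_nexp_sub1 x : nrm (nexp x - 1) <= nrm x * expR (nrm x).
Proof.
have := nexp_tail x 1.
by rewrite big_nat1 /exp_term fact0 invr1 scale1r expr0 expr1.
Qed.

Lemma nrm_nexp_sub2 x : nrm (nexp x - 1 - x) <= nrm x ^+ 2 * expR (nrm x).
Proof.
have := nexp_tail x 2.
by rewrite big_nat_recr//= big_nat1 /exp_term !invr1 !scale1r expr0 expr1 opprD addrA.
Qed.

Lemma nexp0 : nexp 0 = 1.
Proof.
apply/eqP; rewrite -subr_eq0; apply/eqP/nrm_eq0/eqP; rewrite eq_le nrm_ge0 andbT.
by apply: (le_trans (nrm_nexp_sub1 _)); rewrite nrm0 mul0r.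
Qed.

Lemma nexp_dag x : dag (nexp x) = nexp (dag x).
Proof.
apply: (ncvg_unique (ncvg_dag (nexp_cvg x))).
have -> : (fun n => dag (\sum_(0 <= k < n) exp_term x k)) =
    (fun n => \sum_(0 <= k < n) exp_term (dag x) k).
  apply/funext => n; rewrite dag_sum; apply: eq_bigr => k _.
  by rewrite /exp_term dagZ dagX fmorphV /= rmorph_nat.
exact: nexp_cvg.
Qed.

(* The partial sums satisfy [E_n x * E_n y - E_n (x + y)] = a sum of monomials
   with positive coefficients, so its norm is at most the same expression in
   the real numbers [nrm x] and [nrm y], which tends to 0. *)
Lemma nexpD x y : GRing.comm x y -> nexp (x + y) = nexp x * nexp y.
Proof.
move=> xy.

apply: (ncvg_unique _ (ncvgM (nexp_cvg x) (nexp_cvg y))).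
apply: ncvg_eventually (nexp_cvg _) => e e0.
pose D n := exp_psum (nrm x) n * exp_psum (nrm y) n - exp_psum (nrm x + nrm y) n.
have D0 : D @ \oo --> (0 : R).
  have -> : (0 : R) = expR (nrm x) * expR (nrm y) - expR (nrm x + nrm y).
    by rewrite expRD subrr.
  by apply: cvgB; [apply: cvgM|]; exact: cvg_exp_psum.
have /cvgrPdist_lt/(_ _ e0)[N _ hN] := D0.
exists N => n Nn; apply: le_lt_trans (_ : D n < _); last first.
  by have := hN n Nn; rewrite /= sub0r normrN; exact/le_lt_trans/ler_norm.
pose c k : calg A := (k`!%:R : R[i])^-1 *: (1 : calg A).
have cE z k : exp_term z k = c k * z ^+ k by rewrite /c calgZl mul1r.
have c_fact k : c k * k`!%:R = 1.
  rewrite /c calgZl mul1r.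
  have -> : k`!%:R = (k`!%:R : R[i]) *: (1 : calg A) by rewrite scaler_nat.
  by rewrite scalerA mulVf ?scale1r// pnatr_eq0 -lt0n fact_gt0.
have c_central k z : GRing.comm z (c k).
  by rewrite /GRing.comm /c calgZl calgZr mul1r mulr1.
have cr_fact k : (k`!%:R : R)^-1 * k`!%:R = 1.
  by rewrite mulVf// pnatr_eq0 -lt0n fact_gt0.
under [X in nrm (X * _ - _)]eq_bigr do rewrite cE.
under [X in nrm (_ * X - _)]eq_bigr do rewrite cE.
under [X in nrm (_ - X)]eq_bigr do rewrite cE.
rewrite (exp_sum_product c_fact c_central)//.
rewrite /D (exp_sum_product cr_fact (fun k z => mulrC z _))//; last exact: mulrC.
apply: (le_trans (nrm_sum _ _ _)); apply: ler_sum => i _.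
apply: (le_trans (nrm_sum _ _ _)); apply: ler_sum => j _.
have -> : c j * c i * (x ^+ j * y ^+ i) = exp_term x j * exp_term y i.
  by rewrite !cE -!mulrA; congr (_ * _); rewrite !mulrA (c_central i).
apply: (le_trans (nrmM _ _)).
rewrite mulrACA; by apply: ler_pM; rewrite ?nrm_ge0 ?nrm_exp_term.
Qed.

End Exponential.

(** * Inner dynamics *)

(* Otherwise failing unifications unfold [nexp] and do not terminate. *)
Opaque nexp.

Lemma conj_iR (R : realType) (t : R) :
  (('i * t%:C)%C : R[i])^* = (- ('i * t%:C))%C.
Proof.
rewrite rmorphM /= conjCi mulNr; congr (- (_ * _)).
by apply/CrealP/complex_realP; exists t.
Qed.

Section InnerDynamics.
Context {R : realType} {A : cstarAlgType R[i]}.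
Implicit Types (x y H : calg A) (s t h K : R).

Definition evol H t : calg A := nexp (('i * t%:C)%C *: H).

(** The right factor is written as in [finite_volume_dynamics], which makes the two convertible;
    [dynE] gives the symmetric form. *)
Definition dyn H t x : calg A := evol H t * x * nexp ((- ('i * t%:C))%C *: H).

Lemma evolD H s t : evol H (s + t) = evol H s * evol H t.
Proof.
rewrite /evol -nexpD -?scalerDl -?mulrDr ?rmorphD//.
by rewrite /GRing.comm !calgZl !calgZr !scalerA mulrC.
Qed.

Lemma evol0 H : evol H 0 = 1.
Proof. by rewrite /evol mulr0 scale0r nexp0. Qed.

Lemma evolN H t : evol H (- t) = nexp ((- ('i * t%:C))%C *: H).
Proof. by rewrite /evol rmorphN mulrN. Qed.

Lemma evolNK H t : evol H (- t) * evol H t = 1.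
Proof. by rewrite -evolD addNr evol0. Qed.

Lemma evolKN H t : evol H t * evol H (- t) = 1.
Proof. by rewrite -evolD subrr evol0. Qed.

Lemma dynE H t x : dyn H t x = evol H t * x * evol H (- t).
Proof. by rewrite /dyn evolN. Qed.

Lemma dyn_linear H t : linear (dyn H t).
Proof. by move=> c x y; rewrite !dynE mulrDr mulrDl calgZr calgZl. Qed.

HB.instance Definition _ H t :=
  GRing.isLinear.Build R[i] (calg A) (calg A) *:%R (dyn H t) (dyn_linear H t).

Lemma dyn_add H t x y : dyn H t (x + y) = dyn H t x + dyn H t y.
Proof. exact: raddfD. Qed.

Lemma dyn_scale H t c x : dyn H t (c *: x) = c *: dyn H t x.
Proof. exact: linearZ. Qed.

Lemma dynM H t x y : dyn H t (x * y) = dyn H t x * dyn H t y.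
Proof.
rewrite !dynE !mulrA -[_ * _ * _ * evol H t]mulrA evolNK mulr1.
by rewrite -!mulrA.
Qed.

Lemma dyn_comm H t x y : dyn H t (comm x y) = comm (dyn H t x) (dyn H t y).
Proof. by rewrite /comm raddfB /= !dynM. Qed.

Lemma dyn0 H x : dyn H 0 x = x.
Proof. by rewrite dynE oppr0 evol0 mul1r mulr1. Qed.

Lemma dynD H s t x : dyn H (s + t) x = dyn H s (dyn H t x).
Proof. by rewrite !dynE opprD (addrC (- s)) !evolD !mulrA. Qed.

Section SelfAdjoint.
Variable H : calg A.
Hypothesis H_sa : dag H = H.

Lemma dag_evol t : dag (evol H t) = evol H (- t).
Proof.
by rewrite (evolN H t) /evol nexp_dag dagZ H_sa conj_iR.
Qed.

Lemma dyn_dag t x : dag (dyn H t x) = dyn H t (dag x).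
Proof. by rewrite !dynE !dagM !dag_evol opprK mulrA. Qed.

Lemma nrm_dyn t x : nrm (dyn H t x) = nrm x.
Proof.
by rewrite dynE -(dag_evol t) nrm_conj// dag_evol;
  [exact: evolNK|exact: evolKN].
Qed.

Lemma nrm_evol t : nrm (evol H t) <= 1.
Proof. by apply: nrm_unitary; rewrite dag_evol; exact: evolNK. Qed.

Definition rho K h : R := 4 * ((`|h| * K) ^+ 2 * expR (`|h| * K)).

(** With u = [evol H h], u x u* - x = [u, x] u*. Splitting u into 1 + y and a second-order remainder
    leaves two terms of order h^2, each with a factor 2 from [nrm_comm]; hence the 4 in [rho]. *)
Lemma dyn_expansion K h x : nrm H <= K ->
  nrm (dyn H h x - x - ('i * h%:C)%C *: comm H x) <= rho K h * nrm x.
Proof.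
move=> HK; pose y := ('i * h%:C)%C *: H; pose u := evol H h.
have yE : nrm y = `|h| * nrm H by rewrite nrmZi.
have uu : u * dag u = 1 by rewrite /u dag_evol evolKN.
have -> : dyn H h x - x - ('i * h%:C)%C *: comm H x =
    comm (u - 1 - y) x * dag u + comm y x * (dag u - 1).
  have -> : comm (u - 1 - y) x = comm u x - comm y x.
    rewrite !commDl [comm (- 1) x]/comm mulN1r mulrN1 subrr addr0.
    by rewrite -[- y]scaleN1r commZl scaleN1r.
  rewrite mulrBl mulrBr mulr1 addrA subrK -commZl; congr (_ - _).
  by rewrite /comm mulrBl -[x * u * _]mulrA uu mulr1 dynE -(dag_evol h).
have q1 := nrm_nexp_sub1 y; have q2 := nrm_nexp_sub2 y.
have n1 : nrm (comm (u - 1 - y) x * dag u) <=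
    2 * (nrm y ^+ 2 * expR (nrm y) * nrm x).
  apply: (le_trans (nrmM _ _)); apply: (@le_trans _ _ (nrm (comm (u - 1 - y) x))).
    by rewrite ler_piMr ?nrm_ge0// nrm_dag nrm_evol.
  apply: (le_trans (nrm_comm _ _)).
  by rewrite ler_wpM2l// ler_wpM2r ?nrm_ge0.
have n2 : nrm (comm y x * (dag u - 1)) <=
    2 * (nrm y ^+ 2 * expR (nrm y) * nrm x).
  apply: (le_trans (nrmM _ _)).
  have -> : nrm (dag u - 1) = nrm (nexp y - 1) by rewrite -[RHS]nrm_dag dagB dag1.
  apply: (le_trans (ler_pM _ _ (nrm_comm _ _) q1)); rewrite ?nrm_ge0//.
  by rewrite le_eqVlt; apply/orP; left; apply/eqP; ring.
apply: (le_trans (nrmD _ _)); apply: (le_trans (lerD n1 n2)).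
rewrite -mulrDl -natrD mulrA /rho; rewrite ler_wpM2r ?nrm_ge0// ler_wpM2l//.
have yK : nrm y <= `|h| * K by rewrite yE ler_wpM2l.
rewrite ler_pM ?expR_ge0 ?exprn_ge0 ?nrm_ge0 ?ler_expR//.
by rewrite ler_pXn2r ?nnegrE ?nrm_ge0// (le_trans _ yK) ?nrm_ge0.
Qed.

End SelfAdjoint.

Lemma rho_ge0 K h : 0 <= rho K h.
Proof. by rewrite /rho mulr_ge0// mulr_ge0 ?expR_ge0 ?sqr_ge0. Qed.

(** [rho] is quadratic in h, hence negligible against |h|: the errors of M steps of length t / M add
    up to an arbitrarily small total. The bound |h| <= 1 serves to freeze the exponential at
    [expR K]. *)
Lemma rho_small K c : 0 <= K -> 0 < c ->
  exists2 d, 0 < d & forall h, `|h| <= d -> rho K h <= `|h| * c.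
Proof.
move=> K0 c0; pose M := 4 * (K ^+ 2 * expR K) + 1.
have M0 : 0 < M by rewrite ltr_wpDl// mulr_ge0// mulr_ge0 ?sqr_ge0 ?expR_ge0.
exists (Num.min 1 (c / M)); first by rewrite lt_min ltr01 divr_gt0.
move=> h; rewrite le_min => /andP[h1 hc].
have hM : `|h| * M <= c by rewrite -ler_pdivlMr.
apply: (@le_trans _ _ (`|h| * (`|h| * M))); last by rewrite ler_wpM2l.
have -> : rho K h = `|h| * (`|h| * (4 * (K ^+ 2 * expR (`|h| * K)))).
  by rewrite /rho; ring.
rewrite !ler_wpM2l// /M.
apply: (@le_trans _ _ (4 * (K ^+ 2 * expR K))); last by rewrite lerDl.
by rewrite ler_wpM2l// ler_wpM2l ?sqr_ge0// ler_expR ler_piMl.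
Qed.

End InnerDynamics.

(** * Locality *)

Section Locality.
Local Open Scope fset_scope.
Local Open Scope ring_scope.
Context {R : realType} {L : choiceType} (dim : L -> nat).

Definition config_mix (X Z : {fset L}) (s t : config dim Z) : config dim Z :=
  [ffun z : Z => if val z \in X then t z else s z].

(** In the matrix product, the factor a forces the intermediate configuration to agree with the row
    index off X, and b with the column index off Y. Since X and Y partition Z, only [config_mix]
    survives. The resulting product of scalars is symmetric in a and b, whence commutation. *)
Lemma mul_ampl_disjoint (X Y Z : {fset L}) (XZ : X `<=` Z) (YZ : Y `<=` Z)
    (a : @observable R L dim X) (b : @observable R L dim Y)
    (i j : 'I_#|config dim Z|) :
  [disjoint X & Y] -> Z `<=` X `|` Y ->
  (ampl XZ a *m ampl YZ b) i j =
  a (enum_rank (config_restr XZ (enum_val i)))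
    (enum_rank (config_restr XZ (enum_val j))) *
  b (enum_rank (config_restr YZ (enum_val i)))
    (enum_rank (config_restr YZ (enum_val j))).
Proof.
move=> /fdisjointP XY ZXY; rewrite mxE.
set s := enum_val i; set t := enum_val j.
pose r := config_mix X s t.
have mixX : config_restr XZ r = config_restr XZ t.
  by apply/ffunP => x; rewrite !ffunE /= (valP x).
have mixY : config_restr YZ r = config_restr YZ s.
  apply/ffunP => y; rewrite !ffunE /=.
  by rewrite ifN//; apply/negP => /XY; rewrite (valP y).
have off_X : agree_off X s r.
  by apply/forallP => z; apply/implyP => zX; rewrite ffunE (negPf zX).
have off_Y : agree_off Y r t.
  apply/forallP => z; apply/implyP => zY; rewrite ffunE ifT//.
  by have := fsubsetP ZXY _ (valP z); rewrite in_fsetU (negPf zY) orbF.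
rewrite (bigD1 (enum_rank r))//= !mxE -/s -/t !enum_rankK /= off_X off_Y mixX mixY.
rewrite big1 ?addr0// => k kr; rewrite !mxE -/s -/t /=.
case: ifP => hX; last by rewrite mul0r.
case: ifP => hY; last by rewrite mulr0.
case/eqP: kr; apply: (can_inj enum_valK); rewrite enum_rankK.
apply/ffunP => z; rewrite ffunE; case: ifPn => zX.
  have zY := XY _ zX.
  by apply/eqP; exact: (implyP (forallP hY z)).
by apply/eqP; rewrite eq_sym; exact: (implyP (forallP hX z)).
Qed.

Lemma ampl_comm (X Y Z : {fset L}) (XZ : X `<=` Z) (YZ : Y `<=` Z)
    (a : @observable R L dim X) (b : @observable R L dim Y) :
  [disjoint X & Y] -> Z `<=` X `|` Y ->
  ampl XZ a *m ampl YZ b = ampl YZ b *m ampl XZ a.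
Proof.
move=> XY ZXY; apply/matrixP => i j.
rewrite mul_ampl_disjoint// mul_ampl_disjoint 1?mulrC//.
  by rewrite fdisjoint_sym.
by rewrite fsetUC.
Qed.

Context {A : cstarAlgType R[i]}.
Variable iota : forall X : {fset L}, @observable R L dim X -> A.
Hypothesis A_quasilocal : quasilocal_algebra iota.

Definition loc (X : {fset L}) (a : @observable R L dim X) : calg A := iota a.

Lemma comm_disjoint (X Y : {fset L}) (a : @observable R L dim X)
  (b : @observable R L dim Y) : [disjoint X & Y] -> comm (loc a) (loc b) = 0.
Proof.
move=> XY; apply/eqP; rewrite subr_eq0; apply/eqP; rewrite /loc.
have XZ := fsubsetUl X Y; have YZ := fsubsetUr X Y.
rewrite -(iota_ampl A_quasilocal XZ a) -(iota_ampl A_quasilocal YZ b).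
have := ampl_comm XZ YZ a b XY (fsubset_refl _).
move/(congr1 (@iota (X `|` Y))).
by rewrite !(iotaM A_quasilocal).
Qed.

Lemma dag_loc (Phi : interaction R dim) (X : {fset L}) :
  dag (loc (Phi X)) = loc (Phi X).
Proof. by rewrite /dag /loc -(iota_star A_quasilocal) interaction_sa. Qed.

Lemma nrm_loc (X : {fset L}) (a : @observable R L dim X) :
  nrm (loc a) = opnorm a.
Proof. by rewrite /nrm /loc (iota_isometry A_quasilocal). Qed.

End Locality.

(** * Lieb-Robinson bound *)

(** Union bound: a set Z meeting Y is counted on the right once for each common point, hence at
    least once. *)
Lemma sum_meeting_le (R : realType) (L : choiceType) (T : seq {fset L})
    (Y : {fset L}) (f : {fset L} -> R) : (forall Z, 0 <= f Z) ->
  \sum_(Z <- T | ~~ [disjoint Z & Y]%fset) f Z <=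
  \sum_(y <- Y) \sum_(Z <- T | y \in Z) f Z.
Proof.
move=> f0; rewrite (exchange_big_dep xpredT)//= big_mkcond/=.
apply: ler_sum => Z _; case: ifPn => [|_]; last exact: sumr_ge0.
rewrite -fsetI_eq0 => /fset0Pn[y /fsetIP[yZ yY]].
rewrite [leRHS]big_mkcond (bigD1_seq y)//= ?fset_uniq// yZ lerDl.
by apply: sumr_ge0 => z _; case: ifP.
Qed.

Section LiebRobinson.
Local Open Scope fset_scope.
Local Open Scope ring_scope.
Context {R : realType} {L : choiceType} (dim : L -> nat).
Context {A : cstarAlgType R[i]}.
Variable iota : forall X : {fset L}, @observable R L dim X -> A.
Hypothesis A_quasilocal : quasilocal_algebra iota.
Variable Phi : interaction R dim.

Local Notation phi X := (loc iota (Phi X)).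
Local Notation ham V := (hamiltonian iota Phi V : calg A).

Lemma hamE V : ham V = \sum_(X <- fpowerset V) phi X.
Proof. by []. Qed.

Lemma dag_ham V : dag (ham V) = ham V.
Proof.
by rewrite !hamE dag_sum; apply: eq_bigr => X _; exact: dag_loc.
Qed.

(** Later [g y z] is F(d(y, z)), [b] a bound on the interaction norm and [C] the convolution
    constant of F. *)
Variables (g : L -> L -> R) (b C : R).
Hypothesis g_ge0 : forall y z, 0 <= g y z.
Hypothesis b_ge0 : 0 <= b.
Hypothesis C_ge0 : 0 <= C.
Hypothesis phi_le : forall V y z,
  \sum_(Z <- fpowerset V | (y \in Z) && (z \in Z)) nrm (phi Z) <= b * g y z.
Hypothesis g_conv : forall V y z,
  \sum_(x <- enum_fset V) g y x * g x z <= C * g y z.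

(** As Z lies in V, the sum over z in Z can be taken over V and exchanged with the sum over Z; each
    pair (y, z) then collects the interaction terms containing both, bounded by [phi_le]. *)
Lemma sum_meeting_weight (V Y : {fset L}) (w : L -> R) : (forall z, 0 <= w z) ->
  \sum_(Z <- fpowerset V | ~~ [disjoint Z & Y]%fset)
     nrm (phi Z) * (\sum_(z <- Z) w z) <=
  \sum_(y <- Y) b * \sum_(z <- V) g y z * w z.
Proof.
move=> w0; apply: (le_trans (sum_meeting_le _ _ _)).
  by move=> Z; rewrite mulr_ge0 ?nrm_ge0 ?sumr_ge0.
apply: ler_sum => y _.
have -> : \sum_(Z <- fpowerset V | y \in Z) nrm (phi Z) * (\sum_(z <- Z) w z) =
   \sum_(Z <- fpowerset V | y \in Z) \sum_(z <- V | z \in Z) nrm (phi Z) * w z.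
  rewrite big_seq_cond [RHS]big_seq_cond; apply: eq_bigr => Z.
  rewrite fpowersetE => /andP[ZV _]; rewrite mulr_sumr.
  rewrite [LHS]big_seq [RHS]big_seq_cond.
  rewrite -[LHS]big_filter -[RHS]big_filter; apply: perm_big.
  apply: uniq_perm; rewrite ?filter_uniq ?fset_uniq// => z.
  rewrite !mem_filter /= -[z \in enum_fset Z]/(z \in Z) andbb.
  rewrite -[z \in enum_fset V]/(z \in V).
  by case: (boolP (z \in Z)) => zZ; rewrite ?andbF ?andbT//= (fsubsetP ZV _ zZ).
rewrite (exchange_big_dep xpredT)//= mulr_sumr; apply: ler_sum => z _.
by rewrite -mulr_suml mulrA ler_wpM2r.
Qed.

Definition gconv (V : {fset L}) (w : L -> R) (y : L) : R :=
  \sum_(z <- V) g y z * w z.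

Lemma gconv_ge0 V (w : L -> R) y : (forall z, 0 <= w z) -> 0 <= gconv V w y.
Proof. by move=> w0; apply: sumr_ge0 => z _; rewrite mulr_ge0. Qed.

Lemma gconv_gconv V (w : L -> R) y : (forall z, 0 <= w z) ->
  gconv V (gconv V w) y <= C * gconv V w y.
Proof.
move=> w0; rewrite /gconv.
under eq_bigr do rewrite mulr_sumr.
rewrite exchange_big/= mulr_sumr; apply: ler_sum => z _.
by under eq_bigr do rewrite mulrA; rewrite -mulr_suml mulrA ler_wpM2r.
Qed.

Lemma comm_ham (V Y : {fset L}) (a : @observable R L dim Y) :
  comm (ham V) (loc iota a) =
  comm (\sum_(Z <- fpowerset V | ~~ [disjoint Z & Y]%fset) phi Z) (loc iota a).
Proof.
rewrite hamE (bigID (fun Z => [disjoint Z & Y]%fset))/= commDl comm_suml.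
rewrite big1 ?add0r//.
by move=> Z ZY; exact: comm_disjoint.
Qed.

(* Chosen so that [growth_step] holds, i.e. [growth] is a supersolution of the
   discretized Lieb-Robinson recursion. *)
Definition growth_rate : R := 2 * b * (1 + C).

Definition growth (V : {fset L}) (w : L -> R) (s : R) (y : L) : R :=
  w y + expR (growth_rate * s) * gconv V w y.

(** Since E >= 1 and convolving twice costs only a factor C, the convolution of [growth] is at most
    E (1 + C) S. The increment is thus at most [growth_rate * h] times E S, and 1 + r <= exp r
    concludes. *)
Lemma growth_step V (w : L -> R) (s h : R) y :
  (forall z, 0 <= w z) -> 0 <= s -> 0 <= h ->
  growth V w s y + 2 * h * (b * gconv V (growth V w s) y) <= growth V w (s + h) y.
Proof.
move=> w0 s0 h0; rewrite /growth -addrA lerD2l.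
set E := expR (growth_rate * s); set S := gconv V w y.
have E1 : 1 <= E by rewrite /E -expR0 ler_expR !mulr_ge0// addr_ge0.
have S0 : 0 <= S by exact: gconv_ge0.
have -> : gconv V (fun y => w y + E * gconv V w y) y = S + E * gconv V (gconv V w) y.
  rewrite /gconv mulr_sumr -big_split/=; apply: eq_bigr => z _.
  by rewrite mulrDr; congr (_ + _); rewrite mulrCA.
apply: (@le_trans _ _ (E * S + 2 * h * (b * (E * S + E * (C * S))))).
  rewrite lerD2l ler_wpM2l ?mulr_ge0// ler_wpM2l// lerD//.
    by rewrite ler_peMl.
  by rewrite ler_wpM2l ?(le_trans _ E1)// gconv_gconv.
have -> : E * S + 2 * h * (b * (E * S + E * (C * S))) =
    E * (1 + growth_rate * h) * S by rewrite /growth_rate; ring.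
rewrite [growth_rate * (s + h)]mulrDr expRD -/E.
rewrite ler_wpM2r// ler_wpM2l ?(le_trans _ E1)//.
exact: expR_ge1Dx.
Qed.

Lemma growth_ge0 V (w : L -> R) s y : (forall z, 0 <= w z) -> 0 <= growth V w s y.
Proof. by move=> w0; rewrite addr_ge0 ?mulr_ge0 ?expR_ge0 ?gconv_ge0. Qed.

Section OneStep.
Variables (V : {fset L}) (B : calg A) (w : L -> R) (K h eta : R).
Hypothesis w_ge0 : forall z, 0 <= w z.
Hypothesis comm_le : forall (Y : {fset L}) (a : @observable R L dim Y),
  Y `<=` V -> nrm (comm B (loc iota a)) <= nrm (loc iota a) * \sum_(y <- Y) w y.
Hypothesis K_ge : \sum_(Z <- fpowerset V) nrm (phi Z) <= K.
Hypothesis eta_gt0 : 0 < eta.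
Hypothesis h_small : 4 * nrm B * rho K h <= `|h| * eta.

(* The terms of [ham V] that do not meet [Y] commute with [x], so with [HY] the
   sum of the others and [H'], [x'] the evolved [HY], [x], up to [O(h^2)],
   [B, x'] becomes [B, x'] + ih [H', [B, x']] + ih [[B, H'], x'].  The first two
   summands are a unitary rotation of [B, x'], and [B, H'] is a sum of
   commutators with the local terms of [HY], to which the induction hypothesis
   applies. *)
Lemma lieb_robinson_discrete (k : nat) (Y : {fset L}) (a : @observable R L dim Y) :
  Y `<=` V ->
  nrm (comm B (dyn (ham V) (k%:R * h) (loc iota a))) <=
  nrm (loc iota a) * (\sum_(y <- Y) growth V w (k%:R * `|h|) y
                      + eta * expR ((2 * K + 1) * (k%:R * `|h|))).
Proof.
have K0 : 0 <= K by apply: le_trans K_ge; apply: sumr_ge0 => Z _; exact: nrm_ge0.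
(* The support is generalized because the step applies the hypothesis to the interaction terms
   meeting Y, each with its own support. *)
elim: k Y a => [|k IH] Y a YV.
  rewrite !mul0r dyn0 mulr0 expR0 mulr1; apply: (le_trans (comm_le a YV)).
  rewrite ler_wpM2l ?nrm_ge0// ler_wpDr ?(ltW eta_gt0)//.
  by apply: ler_sum => y _; rewrite /growth lerDl mulr_ge0 ?expR_ge0 ?gconv_ge0.
set x := loc iota a; set N := nrm x.
set s := k%:R * `|h|; set E := eta * expR ((2 * K + 1) * s).
set tau := dyn (ham V) (k%:R * h).
have s0 : 0 <= s by rewrite mulr_ge0.
have N0 : 0 <= N by exact: nrm_ge0.
have E0 : 0 <= E by rewrite mulr_ge0 ?expR_ge0// ltW.
pose HY := \sum_(Z <- fpowerset V | ~~ [disjoint Z & Y]%fset) phi Z.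
pose r := dyn (ham V) h x - x - ('i * h%:C)%C *: comm (ham V) x.
have HV_K : nrm (ham V) <= K by rewrite hamE (le_trans (nrm_sum _ _ _)).
have r_le : nrm r <= rho K h * N by apply: dyn_expansion => //; exact: dag_ham.
pose H' := tau HY; pose f := comm B (tau x).
have H'_K : nrm H' <= K.
  rewrite nrm_dyn ?dag_ham//; apply: (le_trans (nrm_sum _ _ _)).
  apply: le_trans K_ge; rewrite [leRHS](bigID (fun Z => [disjoint Z & Y]%fset))/= lerDr.
  by apply: sumr_ge0 => Z _; exact: nrm_ge0.
have H'_sa : dag H' = H'.
  rewrite /H' dyn_dag ?dag_ham//; congr (tau _).
  by rewrite dag_sum; apply: eq_bigr => X _; exact: dag_loc.
(* This crude bound involves [nrm B], but it only enters multiplied by [rho K h]. *)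
have f_le : nrm f <= 2 * nrm B * N.
  by rewrite (le_trans (nrm_comm _ _))// nrm_dyn ?dag_ham// mulrA.
pose r' := dyn H' h f - f - ('i * h%:C)%C *: comm H' f.
have r'_le : nrm r' <= rho K h * nrm f by exact: dyn_expansion.
have eq_step : comm B (dyn (ham V) (k.+1%:R * h) x) =
    dyn H' h f - r' + ('i * h%:C)%C *: comm (comm B H') (tau x) + comm B (tau r).
  have -> : dyn (ham V) (k.+1%:R * h) x =
      tau (x + ('i * h%:C)%C *: comm HY x + r).
    rewrite -natr1 mulrDl mul1r dynD /r -comm_ham /tau; congr (dyn _ _ _).
    by rewrite -[X in _ + X]addrA -opprD [RHS]addrC subrK.
  rewrite /tau dyn_add [dyn _ _ (x + _)]dyn_add dyn_scale dyn_comm -/tau.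
  rewrite commDr [comm B (tau x + _)]commDr commZr comm_jacobi.
  rewrite -/f -/H' scalerDr [f + (_ + _)]addrA; congr (_ + _ + _).
  by rewrite /r' -[X in _ - X]addrA -opprD opprB [RHS]addrCA subrr addr0.
have BH_le : nrm (comm B H') <=
    \sum_(y <- Y) b * gconv V (growth V w s) y + K * E.
  rewrite /H' /HY /tau raddf_sum /= comm_sumr.
  apply: (le_trans (nrm_sum _ _ _)).
  apply: (@le_trans _ _ (\sum_(Z <- fpowerset V | ~~ [disjoint Z & Y]%fset)
     (nrm (phi Z) * (\sum_(z <- Z) growth V w s z) + nrm (phi Z) * E))).
    rewrite big_seq_cond [leRHS]big_seq_cond; apply: ler_sum => Z.
    by rewrite fpowersetE => /andP[ZV _]; rewrite -mulrDr; exact: IH.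
  rewrite big_split/=; apply: lerD.
    by apply: sum_meeting_weight => z; exact: growth_ge0.
  rewrite -mulr_suml ler_wpM2r//; apply: le_trans K_ge.
  rewrite [leRHS](bigID (fun Z => [disjoint Z & Y]%fset))/= lerDr.
  by apply: sumr_ge0 => Z _; exact: nrm_ge0.
have fG := IH _ a YV; rewrite -/tau -/f -/x -/N -/s -/E in fG.
have sE : k.+1%:R * `|h| = s + `|h| by rewrite -natr1 mulrDl mul1r.
rewrite eq_step sE.
have t1 : nrm (dyn H' h f - r') <=
    N * (\sum_(y <- Y) growth V w s y + E) + 2 * nrm B * rho K h * N.
  apply: (le_trans (nrmB _ _)); rewrite nrm_dyn//; apply: lerD => //.
  apply: (le_trans r'_le); apply: (le_trans (ler_wpM2l (rho_ge0 _ _) f_le)).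
  by rewrite [leRHS]mulrAC mulrC.
have t2 : nrm (('i * h%:C)%C *: comm (comm B H') (tau x)) <=
    N * (2 * `|h| * (\sum_(y <- Y) b * gconv V (growth V w s) y + K * E)).
  rewrite nrmZi.
  apply: (@le_trans _ _ (N * (2 * `|h| * nrm (comm B H')))); last first.
    by rewrite !ler_wpM2l ?mulr_ge0.
  have := ler_wpM2l (normr_ge0 h) (nrm_comm (comm B H') (tau x)).
  rewrite nrm_dyn ?dag_ham// -/N => /le_trans; apply.
  by rewrite le_eqVlt; apply/orP; left; apply/eqP; ring.
have t3 : nrm (comm B (tau r)) <= 2 * nrm B * rho K h * N.
  apply: (le_trans (nrm_comm _ _)); rewrite nrm_dyn ?dag_ham//.
  by have := ler_wpM2l (nrm_ge0 B) r_le => hr; lra.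
apply: (le_trans (nrmD _ _)); apply: (le_trans (lerD (nrmD _ _) (lexx _))).
apply: (le_trans (lerD (lerD t1 t2) t3)).
have -> : forall G G' : R, N * (G + E) + 2 * nrm B * rho K h * N +
    N * (2 * `|h| * (G' + K * E)) + 2 * nrm B * rho K h * N =
    N * ((G + 2 * `|h| * G') + (E * (1 + 2 * `|h| * K) + 4 * nrm B * rho K h)).
  by move=> G G'; ring.
rewrite ler_wpM2l//; apply: lerD.
  rewrite mulr_sumr -big_split/=; apply: ler_sum => y _; exact: growth_step.
(* In the rate 2 K + 1, the part 2 K pays for the source term and the 1 for the discretization
   errors, which [h_small] bounds by |h| eta <= |h| E. *)
apply: (@le_trans _ _ (E * (1 + (2 * K + 1) * `|h|))).
  have etaE : eta <= E.
    rewrite /E ler_peMr ?(ltW eta_gt0)// -expR0 ler_expR mulr_ge0//.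
    by rewrite addr_ge0 ?mulr_ge0.
  have : `|h| * eta <= `|h| * E by rewrite ler_wpM2l.
  by move=> hE; apply: (le_trans (lerD (lexx _) (le_trans h_small hE))); lra.
rewrite [(2 * K + 1) * (s + _)]mulrDr expRD mulrA -/E ler_wpM2l//; exact: expR_ge1Dx.
Qed.

End OneStep.

(** * Comparison of two finite volumes *)

Definition crossing (V W : {fset L}) : seq {fset L} :=
  [seq X <- fpowerset W | ~~ (X `<=` V)].

(** The factor 2 is that of [nrm_comm], so that this weight fits [comm_le] as it stands. *)
Definition boundary (V W : {fset L}) (y : L) : R :=
  2 * \sum_(X <- crossing V W | y \in X) nrm (phi X).

Lemma boundary_ge0 V W y : 0 <= boundary V W y.
Proof. by rewrite mulr_ge0// sumr_ge0// => X _; exact: nrm_ge0. Qed.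

Lemma sum_fpowerset_sub (B : nmodType) (V W : {fset L}) (f : {fset L} -> B) :
  V `<=` W ->
  \sum_(X <- fpowerset W | X `<=` V) f X = \sum_(X <- fpowerset V) f X.
Proof.
move=> VW; rewrite -[LHS]big_filter; apply: perm_big; apply: uniq_perm.
- by rewrite filter_uniq// fset_uniq.
- exact: fset_uniq.
move=> X; rewrite mem_filter.
rewrite -[X \in enum_fset (fpowerset V)]/(X \in fpowerset V).
rewrite -[X \in enum_fset (fpowerset W)]/(X \in fpowerset W) !fpowersetE.
by case: (boolP (X `<=` V)) => //= XV; exact: fsubset_trans VW.
Qed.

Lemma hamB (V W : {fset L}) : V `<=` W ->
  ham W - ham V = \sum_(X <- crossing V W) phi X.
Proof.
move=> VW; rewrite !hamE (bigID (fun X => X `<=` V))/= sum_fpowerset_sub//.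
by rewrite addrAC subrr add0r big_filter.
Qed.

Lemma comm_hamB (V W Y : {fset L}) (a : @observable R L dim Y) :
  V `<=` W -> nrm (comm (ham W - ham V) (loc iota a)) <=
  nrm (loc iota a) * \sum_(y <- Y) boundary V W y.
Proof.
move=> VW; rewrite hamB// (bigID (fun Z => [disjoint Z & Y]%fset))/=.
rewrite commDl comm_suml big1 ?add0r => [|Z ZY]; last exact: comm_disjoint.
rewrite comm_suml; apply: (le_trans (nrm_sum _ _ _)).
apply: (@le_trans _ _ (\sum_(Z <- crossing V W | ~~ [disjoint Z & Y]%fset)
    nrm (loc iota a) * 2 * nrm (phi Z))).
  by apply: ler_sum => Z _; rewrite (le_trans (nrm_comm _ _))//; lra.
rewrite -mulr_sumr /boundary -mulr_sumr mulrA ler_wpM2l ?mulr_ge0 ?nrm_ge0//.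
by apply: sum_meeting_le => Z; exact: nrm_ge0.
Qed.

(** The two first-order expansions share the term x, so only the commutator with the difference of
    the Hamiltonians and two remainders are left. *)
Lemma dyn_diff_step (V W : {fset L}) (K h : R) (x : calg A) :
  nrm (ham V) <= K -> nrm (ham W) <= K ->
  nrm (dyn (ham W) h x - dyn (ham V) h x) <=
  `|h| * nrm (comm (ham W - ham V) x) + 2 * rho K h * nrm x.
Proof.
move=> VK WK; set c := ('i * h%:C)%C.
have hV := dyn_expansion (dag_ham V) h x VK.
have hW := dyn_expansion (dag_ham W) h x WK.
rewrite -/c in hV hW.
set rV := dyn (ham V) h x - x - c *: _ in hV.
set rW := dyn (ham W) h x - x - c *: _ in hW.
have -> : dyn (ham W) h x - dyn (ham V) h x =
    c *: comm (ham W - ham V) x + (rW - rV).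
  have -> : comm (ham W - ham V) x = comm (ham W) x - comm (ham V) x.
    by rewrite commDl -scaleN1r commZl scaleN1r.
  rewrite /rW /rV scalerBr !opprB !addrA.
  by rewrite [RHS](AC 8 ((3*8)*(1*5)*(6*2)*(7*4))) /= !subrr !addr0.
apply: (le_trans (nrmD _ _)); rewrite nrmZi lerD2l.
by apply: (le_trans (nrmB _ _)); apply: (le_trans (lerD hW hV)); lra.
Qed.

(** Discrete Duhamel formula: over M steps of length h = t / M the differences made in single steps
    add up, each controlled by the discrete Lieb-Robinson bound. *)
Lemma finite_volume_compare (V W Y : {fset L}) (a : @observable R L dim Y)
    (t : R) :
  Y `<=` V -> V `<=` W ->
  nrm (dyn (ham W) t (loc iota a) - dyn (ham V) t (loc iota a)) <=
  `|t| * (nrm (loc iota a) * \sum_(y <- Y) growth V (boundary V W) `|t| y).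
Proof.
move=> YV VW; set x := loc iota a; set N := nrm x.
set B := ham W - ham V; set G := \sum_(y <- Y) _.
pose K := \sum_(Z <- fpowerset W) nrm (phi Z).
have K0 : 0 <= K by apply: sumr_ge0 => Z _; exact: nrm_ge0.
have VK : \sum_(Z <- fpowerset V) nrm (phi Z) <= K.
  rewrite -(sum_fpowerset_sub _ VW) /K [leRHS](bigID (fun X => X `<=` V))/= lerDl.
  by apply: sumr_ge0 => Z _; exact: nrm_ge0.
have hamV_K : nrm (ham V) <= K by rewrite hamE (le_trans (nrm_sum _ _ _)).
have hamW_K : nrm (ham W) <= K by rewrite hamE (le_trans (nrm_sum _ _ _)).
pose E := expR ((2 * K + 1) * `|t|).
have E0 : 0 <= E by exact: expR_ge0.
have N0 : 0 <= N by exact: nrm_ge0.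
have w0 := boundary_ge0 V W.
have G0 : 0 <= G by apply: sumr_ge0 => y _; exact: growth_ge0.
have approx eta : 0 < eta ->
    nrm (dyn (ham W) t x - dyn (ham V) t x) <= `|t| * (N * (G + eta * E + eta)).
  move=> eta0.
  (* With this denominator a single bound on [rho K h] yields both [h_small] and the remainder 2
     [rho K h] of [dyn_diff_step]. *)
  have D0 : 0 < 4 * nrm B + 2 by rewrite ltr_wpDl ?mulr_ge0 ?nrm_ge0.
  have [d d0 hd] := rho_small K0 (divr_gt0 eta0 D0).
  pose M := (Num.truncn (`|t| / d)).+1.
  have M0 : 0 < (M%:R : R) by rewrite ltr0n.
  have tM : `|t| / d < M%:R by rewrite truncnS_gt.
  pose h := t / M%:R.
  have Mh : M%:R * h = t by rewrite mulrC divfK ?gt_eqF.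
  have hE : M%:R * `|h| = `|t| by rewrite -Mh [RHS]normrM (ger0_norm (ltW M0)).
  have h_le : `|h| <= d.
    by rewrite -(ler_pM2l M0) hE -ler_pdivrMr// ltW.
  have rho_le : rho K h * (4 * nrm B + 2) <= `|h| * eta.
    by have := hd _ h_le; rewrite mulrA ler_pdivlMr.
  have rho0 := rho_ge0 K h.
  have h_small : 4 * nrm B * rho K h <= `|h| * eta by lra.
  have h_small2 : 2 * rho K h <= `|h| * eta.
    have := mulr_ge0 rho0 (nrm_ge0 B); lra.
  rewrite -{1 2}Mh -hE.
  suff main k : (k <= M)%N ->
      nrm (dyn (ham W) (k%:R * h) x - dyn (ham V) (k%:R * h) x) <=
      k%:R * `|h| * (N * (G + eta * E + eta)) by exact: main.
  elim: k => [_|k IH kM]; first by rewrite !mul0r !dyn0 subrr nrm0.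
  have sk : k.+1%:R * h = h + k%:R * h by rewrite -natr1 mulrDl mul1r addrC.
  rewrite sk !dynD -natr1 !mulrDl mul1r.
  set u := dyn (ham W) _ x in IH *; set v := dyn (ham V) _ x in IH *.
  (* Passing through the W-step of v, the first difference is the previous one by isometry, and the
     second compares single steps from the same v. *)
  apply: (le_trans (nrm_tri (dyn (ham W) h v) _ _)).
  apply: lerD.
    rewrite -raddfB /= nrm_dyn ?dag_ham//; apply: IH; exact: ltnW.
  apply: (le_trans (dyn_diff_step h v hamV_K hamW_K)).
  have -> : nrm v = N by rewrite nrm_dyn// dag_ham.
  have hB := lieb_robinson_discrete w0 (fun Z b _ => comm_hamB b VW)
    VK eta0 h_small k a YV.
  rewrite -/x -/N -/v -/B in hB.
  have kt : k%:R * `|h| <= `|t|.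
    by rewrite -hE ler_wpM2r// ler_nat ltnW.
  have hB' : nrm (comm B v) <= N * (G + eta * E).
    apply: (le_trans hB); rewrite ler_wpM2l//; apply: lerD.
      apply: ler_sum => y _; rewrite /growth lerD2l ler_wpM2r ?gconv_ge0//.
      by rewrite ler_expR ler_wpM2l// !mulr_ge0// addr_ge0.
    by rewrite ler_wpM2l ?(ltW eta0)// ler_expR ler_wpM2l// addr_ge0 ?mulr_ge0.
  have := ler_wpM2l (normr_ge0 h) hB'.
  have := ler_wpM2r N0 h_small2.
  lra.
apply/ler_addgt0Pr => e e0.
(* Taking eta = e / D makes the part depending on eta at most e; the final 1 keeps D positive. *)
pose D := `|t| * (N * (E + 1)) + 1.
have D0 : 0 < D by rewrite ltr_wpDl// mulr_ge0// mulr_ge0// addr_ge0.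
apply: (le_trans (approx _ (divr_gt0 e0 D0))).
have -> : `|t| * (N * (G + e / D * E + e / D)) =
   `|t| * (N * G) + e / D * (`|t| * (N * (E + 1))) by ring.
by rewrite lerD2l mulrAC ler_pdivrMr// ler_wpM2l ?(ltW e0)// /D lerDl.
Qed.

End LiebRobinson.

(** * Smallness of the boundary terms *)

(** Converts the supremum conditions on F and on the interaction into uniform bounds on finite sums.
    The maximum with 0 supplies [0 <= M]. *)
Lemma ereal_sup_esum_bound (R : realType) (I : Type) (T : choiceType)
    (D : I -> set T) (f : I -> T -> R) :
  (ereal_sup [set \esum_(i in D p) (f p i)%:E | p in [set: I]] < +oo)%E ->
  exists2 M : R, 0 <= M & forall p (s : seq T), uniq s ->
    (forall i, i \in s -> D p i) -> \sum_(i <- s) f p i <= M.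
Proof.
set S := ereal_sup _ => S_fin.
exists (Num.max 0 (fine S)); first by rewrite le_max lexx.
move=> p s s_uniq sD; rewrite le_max; apply/orP; right.
have leS : ((\sum_(i <- s) f p i)%:E <= S)%E.
  apply: (@le_trans _ _ (\esum_(i in D p) (f p i)%:E)); last first.
    by apply: ereal_sup_ubound; exists p.
  apply: esum_ge; exists [set` s]; first by split => //; exact: finite_seq.
  by rewrite -fsbig_seq// sumEFin.
have S_num : S \is a fin_num.
  by rewrite fin_numElt S_fin andbT (lt_le_trans _ leS)// ltNyr.
by rewrite -lee_fin fineK.
Qed.

(** If s0 comes within e of the supremum of all finite sums, a disjoint s with sum above e would
    exceed that supremum. *)
Lemma small_tail (R : realType) (T : eqType) (P : pred T) (f : T -> R) (M : R) :
  (forall s, uniq s -> all P s -> \sum_(i <- s) f i <= M) ->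
  forall e, 0 < e -> exists2 s0 : seq T, all P s0 &
    forall s, uniq s -> all P s -> (forall i, i \in s -> i \notin s0) ->
      \sum_(i <- s) f i <= e.
Proof.
move=> hM e e0.
pose S := [set x | exists2 s : seq T, uniq s /\ all P s & x = \sum_(i <- s) f i].
have supS : has_sup S.
  split; first by exists 0, [::]; rewrite ?big_nil.
  by exists M => _ [s [us Ps] ->]; exact: hM.
have [_ [s0 [us0 Ps0] ->] lt_s0] := sup_adherent e0 supS.
exists s0 => // s us Ps dis.
have : \sum_(i <- s0 ++ s) f i <= sup S.
  apply: sup_upper_bound => //; exists (s0 ++ s) => //; split.
    rewrite cat_uniq us0 us andbT /=; apply/hasPn => i; exact: dis.
  by rewrite all_cat Ps0.
by rewrite big_cat /= => h; lra.
Qed.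

Section Smallness.
Local Open Scope fset_scope.
Local Open Scope ring_scope.
Context {R : realType} {L : choiceType} (dim : L -> nat).
Context {A : cstarAlgType R[i]}.
Variable iota : forall X : {fset L}, @observable R L dim X -> A.
Variable Phi : interaction R dim.
Local Notation phi X := (loc iota (Phi X)).

Variables (g : L -> L -> R) (b M C : R).
Hypothesis g_ge0 : forall y z, 0 <= g y z.
Hypothesis b_ge0 : 0 <= b.
Hypothesis C_ge0 : 0 <= C.
Hypothesis M_ge0 : 0 <= M.
Hypothesis phi_le : forall y z (s : seq {fset L}), uniq s ->
  (forall X, X \in s -> y \in X /\ z \in X) ->
  \sum_(Z <- s) nrm (phi Z) <= b * g y z.
Hypothesis g_sum : forall y (s : seq L), uniq s -> \sum_(z <- s) g y z <= M.

Lemma boundary_le V W y : boundary iota Phi V W y <= 2 * (b * M).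
Proof.
rewrite /boundary ler_wpM2l//.
apply: (@le_trans _ _ (b * g y y)).
  rewrite -big_filter; apply: phi_le.
    by rewrite !filter_uniq// fset_uniq.
  by move=> X; rewrite mem_filter => /andP[].
rewrite ler_wpM2l//; have := @g_sum y [:: y] isT; by rewrite big_seq1.
Qed.

(** V is built in two stages: U adds to Y the points carrying all but d of each [g y], and V adds to
    U the sets carrying all but d / 2 of the interaction at each point of U. The boundary weight is
    then at most d on U, while off U it is merely bounded but meets a small tail of g. *)
Lemma growth_small (Y : {fset L}) (T e : R) : 0 < e ->
  exists2 V : {fset L}, Y `<=` V & forall W : {fset L}, forall s, s <= T ->
    \sum_(y <- Y) growth g b C V (boundary iota Phi V W) s y <= e.
Proof.
move=> e0.
pose c := expR (growth_rate b C * T).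
have c0 : 0 <= c by exact: expR_ge0.
pose n : R := (size (enum_fset Y))%:R.
(* This is the bound obtained at one y in units of d, times the number of points; the 1 keeps D
   positive when Y is empty. *)
pose D := n * (1 + c * (M + 2 * (b * M))) + 1.
have D0 : 0 < D.
  rewrite ltr_wpDl// mulr_ge0 ?ler0n// addr_ge0// mulr_ge0//.
  by rewrite addr_ge0 ?mulr_ge0.
pose d := e / D.
have d0 : 0 < d by rewrite divr_gt0.
have /choice[tailg hg] : forall y, exists U : seq L, forall s, uniq s ->
    (forall z, z \in s -> z \notin U) -> \sum_(z <- s) g y z <= d.
  move=> y.
  have [U _ hU] := @small_tail R L xpredT (g y) M (fun s us _ => g_sum y us) d d0.
  by exists U => s us; apply: hU => //; exact/allP.
have /choice[tailphi hphi] : forall z : L, exists S : seq {fset L},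
    forall s : seq {fset L}, uniq s ->
    (forall X, X \in s -> z \in X) -> (forall X, X \in s -> X \notin S) ->
    \sum_(X <- s) nrm (phi X) <= d / 2.
  move=> z.
  have bound s : uniq s -> all (fun X : {fset L} => z \in X) s ->
      \sum_(X <- s) nrm (phi X) <= b * g z z.
    by move=> us /allP zs; apply: phi_le => // X /zs.
  have [S _ hS] := small_tail bound (divr_gt0 d0 (ltr0Sn _ 1)).
  by exists S => s us hs; apply: hS => //; exact/allP.
pose U := Y `|` [fset z in flatten [seq tailg y | y <- enum_fset Y]].
pose V := U `|` [fset z in flatten
  [seq enum_fset X | X <- flatten [seq tailphi z | z <- enum_fset U]]].
exists V => [|W s sT]; first by rewrite /V /U -fsetUA fsubsetUl.
pose w := boundary iota Phi V W.
have w0 z : 0 <= w z by exact: boundary_ge0.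
have wU z : z \in U -> w z <= d.
  move=> zU; rewrite /w /boundary -ler_pdivlMl// mulrC -big_filter; apply: (hphi z).
  - by rewrite !filter_uniq// fset_uniq.
  - by move=> X; rewrite mem_filter => /andP[].
  (* V contains every member of [tailphi z], so a set not included in V lies outside that list. *)
  move=> X; rewrite !mem_filter => /and3P[_ XV _]; apply: contra XV => XS.
  apply/fsubsetP => x xX; rewrite in_fsetU; apply/orP; right.
  rewrite in_fset; apply/flattenP; exists (enum_fset X) => //.
  by apply: map_f; apply/flatten_mapP; exists z.
apply: (@le_trans _ _ (\sum_(y <- Y) (d * (1 + c * (M + 2 * (b * M)))))); last first.
  rewrite big_const_seq count_predT iter_addr_0 -[leLHS]mulr_natl -/n /d.
  set Z := 1 + _; have -> : n * (e / D * Z) = e * (n * Z) / D by ring.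
  by rewrite ler_pdivrMr// ler_wpM2l ?(ltW e0)// lerDl.
rewrite big_seq [leRHS]big_seq; apply: ler_sum => y yY.
have yU : y \in U by rewrite in_fsetU yY.
have conv_le : gconv g V w y <= d * (M + 2 * (b * M)).
  rewrite /gconv (bigID (fun z => z \in U))/= mulrDr; apply: lerD.
    apply: (@le_trans _ _ (\sum_(z <- V | z \in U) g y z * d)).
      by apply: ler_sum => z zU; rewrite ler_wpM2l// wU.
    rewrite -mulr_suml mulrC ler_wpM2l ?(ltW d0)// -big_filter g_sum//.
    by rewrite filter_uniq// fset_uniq.
  apply: (@le_trans _ _ (\sum_(z <- V | z \notin U) g y z * (2 * (b * M)))).
    by apply: ler_sum => z _; rewrite ler_wpM2l// boundary_le.
  rewrite -mulr_suml ler_wpM2r ?mulr_ge0// -big_filter hg//.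
    by rewrite filter_uniq// fset_uniq.
  move=> z; rewrite mem_filter => /andP[zU _]; apply: contra zU => zt.
  rewrite in_fsetU; apply/orP; right; rewrite in_fset.
  by apply/flatten_mapP; exists y.
rewrite /growth -/w mulrDr mulr1; apply: lerD; first exact: wU.
apply: (@le_trans _ _ (c * gconv g V w y)).
  rewrite ler_wpM2r ?gconv_ge0// ler_expR ler_wpM2l// /growth_rate.
  by rewrite !mulr_ge0// addr_ge0.
by rewrite mulrCA ler_wpM2l.
Qed.

End Smallness.

(** * The infinite-volume dynamics *)

Section LimitDynamics.
Context {R : realType} {A : cstarAlgType R[i]}.
Variable H : nat -> calg A.
Hypothesis H_sa : forall n, dag (H n) = H n.
Hypothesis H_cauchy : forall (x : calg A) (T e : R), 0 < e ->
  exists N, forall m n, (N <= m)%N -> (N <= n)%N -> forall t, `|t| <= T ->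
    nrm (dyn (H m) t x - dyn (H n) t x) < e.

Definition limit_dyn (t : R) (x : calg A) : calg A := limn (fun n => dyn (H n) t x).

Lemma limit_dyn_cvg t x : ncvg (fun n => dyn (H n) t x) (limit_dyn t x).
Proof.
apply: ncauchy_cvg => e /(H_cauchy x `|t|)[N hN].
by exists N => n m Nn Nm; exact: hN.
Qed.

(** The second index of the Cauchy estimate goes to infinity: N' may depend on t, but N does not. *)
Lemma limit_dyn_uniform x (T e : R) : 0 < e -> exists N, forall n, (N <= n)%N ->
  forall t, `|t| <= T -> nrm (dyn (H n) t x - limit_dyn t x) <= e.
Proof.
move=> /(H_cauchy x T)[N hN]; exists N => n Nn t tT.
apply/ler_addgt0Pr => d /(limit_dyn_cvg t x)[N' hN'].
apply: (le_trans (nrm_tri (dyn (H (maxn N N')) t x) _ _)); apply: lerD.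
  by apply/ltW/hN; rewrite ?leq_maxl.
by apply/ltW/hN'; rewrite leq_maxr.
Qed.

Lemma nrm_limit_dyn t x : nrm (limit_dyn t x) <= nrm x.
Proof. by apply: (ncvg_le (limit_dyn_cvg t x)) => n; rewrite nrm_dyn. Qed.

Lemma limit_dyn_linear t : linear (limit_dyn t).
Proof.
move=> c x y; apply: ncvg_unique (limit_dyn_cvg _ _) _.
have -> : (fun n => dyn (H n) t (c *: x + y)) =
    (fun n => c *: dyn (H n) t x + dyn (H n) t y).
  by apply/funext => n; rewrite dyn_add dyn_scale.
by apply: ncvgD; [apply: ncvgZ|]; exact: limit_dyn_cvg.
Qed.

Lemma limit_dynM t : {morph limit_dyn t : x y / x * y}.
Proof.
move=> x y; apply: ncvg_unique (limit_dyn_cvg _ _) _.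
have -> : (fun n => dyn (H n) t (x * y)) =
    (fun n => dyn (H n) t x * dyn (H n) t y).
  by apply/funext => n; rewrite dynM.
by apply: ncvgM; exact: limit_dyn_cvg.
Qed.

Lemma limit_dyn_dag t : {morph limit_dyn t : x / dag x}.
Proof.
move=> x; apply: ncvg_unique (limit_dyn_cvg _ _) _.
have -> : (fun n => dyn (H n) t (dag x)) = (fun n => dag (dyn (H n) t x)).
  by apply/funext => n; rewrite dyn_dag.
by apply: ncvg_dag; exact: limit_dyn_cvg.
Qed.

Lemma limit_dyn0 x : limit_dyn 0 x = x.
Proof.
apply: ncvg_unique (limit_dyn_cvg _ _) _.
have -> : (fun n => dyn (H n) 0 x) = fun=> x by apply/funext => n; rewrite dyn0.
exact: ncvg_cst.
Qed.

(** Isometry of [dyn (H n) s] allows [dyn (H n) t x] to be replaced by its limit inside it. *)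
Lemma limit_dynD s t x : limit_dyn (s + t) x = limit_dyn s (limit_dyn t x).
Proof.
apply: ncvg_unique (limit_dyn_cvg _ _) _.
apply: ncvg_eventually (limit_dyn_cvg _ _) => e /(limit_dyn_cvg t x)[N hN].
exists N => n Nn; rewrite dynD -scaleN1r -dyn_scale -dyn_add scaleN1r nrm_dyn//.
exact: hN.
Qed.

Lemma limit_dyn_automorphism_group :
  automorphism_group (limit_dyn : R -> A -> A).
Proof.
split => [t|x|s t x]; [|exact: limit_dyn0|exact: limit_dynD].
split; [exact: limit_dyn_linear|exact: limit_dynM|exact: limit_dyn_dag|].
by exists (limit_dyn (- t)) => x;
  rewrite -limit_dynD ?addNr ?subrr limit_dyn0.
Qed.

Lemma dyn_near0 (h : calg A) x (e : R) : dag h = h -> 0 < e ->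
  exists2 d : R, 0 < d & forall t, `|t| <= d -> nrm (dyn h t x - x) <= e.
Proof.
move=> h_sa e0.
have [d d0 hd] := rho_small (nrm_ge0 h) (@ltr01 R).
pose D := nrm x + nrm (comm h x) + 1.
have D0 : 0 < D by rewrite ltr_wpDl// addr_ge0 ?nrm_ge0.
exists (Num.min d (e / D)); first by rewrite lt_min d0 divr_gt0.
move=> t; rewrite le_min => /andP[td te].
rewrite ler_pdivlMr// in te; apply: le_trans te.
rewrite -[dyn h t x - x](subrK (('i * t%:C)%C *: comm h x)).
apply: (le_trans (nrmD _ _)); rewrite nrmZi.
apply: (le_trans (lerD (dyn_expansion h_sa t x (lexx _)) (lexx _))).
have := ler_wpM2r (nrm_ge0 x) (hd _ td); rewrite /D.
have := normr_ge0 t; lra.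
Qed.

(** For |t| <= 1 the limit is uniformly close to one inner dynamics, which is continuous at 0 by
    [dyn_near0]. *)
Lemma limit_dyn_near0 x (e : R) : 0 < e ->
  exists2 d : R, 0 < d & forall t, `|t| <= d -> nrm (limit_dyn t x - x) <= e.
Proof.
move=> e0; have e2 : 0 < e / 2 by rewrite divr_gt0.
have [N hN] := limit_dyn_uniform x 1 e2.
have [d d0 hd] := dyn_near0 x (H_sa N) e2.
exists (Num.min d 1); first by rewrite lt_min d0 ltr01.
move=> t; rewrite le_min => /andP[td t1].
rewrite [e]splitr (le_trans (nrm_tri (dyn (H N) t x) _ _))// lerD ?hd//.
by rewrite nrmBC hN.
Qed.

Lemma limit_dyn_continuous : strongly_continuous (limit_dyn : R -> A -> A).
Proof.
move=> x t; apply/cvgrPdist_le => e /Re_gt0[e0 ->].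
have [d d0 hd] := limit_dyn_near0 x e0.
apply: filterS (nbhsx_ballx t d d0) => s.
rewrite -ball_normE /= => ts.
rewrite (nrmE (limit_dyn t x - limit_dyn s x : calg A)) lecR.
(* The group law and contractivity reduce continuity at t to continuity at 0. *)
have -> : limit_dyn t x - limit_dyn s x = limit_dyn s (limit_dyn (t - s) x - x).
  have lin := limit_dyn_linear s (-1) x (limit_dyn (t - s) x).
  rewrite !scaleN1r in lin.
  by rewrite [_ - x]addrC lin -limit_dynD [s + _]addrC subrK addrC.
by rewrite (le_trans (nrm_limit_dyn _ _))// hd// ltW.
Qed.

End LimitDynamics.

(** * From local observables to the whole algebra *)

Section ThermodynamicLimit.
Local Open Scope fset_scope.
Local Open Scope ring_scope.
Context {R : realType} {L : choiceType} (dim : L -> nat).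
Context {A : cstarAlgType R[i]}.
Variable iota : forall X : {fset L}, @observable R L dim X -> A.
Hypothesis A_quasilocal : quasilocal_algebra iota.
Variable Phi : interaction R dim.
Local Notation ham V := (hamiltonian iota Phi V : calg A).

Lemma loc_dense (x : calg A) (e : R) : 0 < e ->
  exists (Y : {fset L}) (a : @observable R L dim Y), nrm (x - loc iota a) < e.
Proof.
move=> e0; have eC : 0 < (e%:C%C : R[i]) by rewrite ltcR.
have /(_ (ball (x : A) e%:C%C))[||y [yb [Y _ [a _ ya]]]] := iota_dense A_quasilocal.
- by exists x; exact: ballxx.
- exact: ball_open.
by exists Y, a; move: yb; rewrite /loc ya -ball_normE /= nrmE ltcR.
Qed.

Lemma exhausting_contains (V : nat -> {fset L}) : exhausting V ->
  forall X : {fset L}, exists N, forall n, (N <= n)%N -> X `<=` V n.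
Proof.
move=> [V_incr V_exh]; elim/fset1U_rect => [|x X _ [N hN]].
  by exists 0%N => n _; exact: fsub0set.
have [M xM] := V_exh x; exists (maxn N M) => n; rewrite geq_max => /andP[Nn Mn].
rewrite fsubUset hN// andbT fsub1set.
exact: fsubsetP (V_incr _ _ Mn) _ xM.
Qed.

Hypothesis local_limit : forall (Y : {fset L}) (a : @observable R L dim Y) (T e : R),
  0 < e -> exists V, forall W, V `<=` W -> forall t, `|t| <= T ->
    nrm (dyn (ham W) t (loc iota a) - dyn (ham V) t (loc iota a)) <= e.

(** The finite-volume dynamics are isometric, so replacing x by a nearby local observable costs the
    same in every volume and at every time. *)
Lemma global_limit (x : calg A) (T e : R) :
  0 < e -> exists V, forall W, V `<=` W -> forall t, `|t| <= T ->
    nrm (dyn (ham W) t x - dyn (ham V) t x) <= e.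
Proof.
move=> e0; have e3 : 0 < e / 3 by rewrite divr_gt0.
have [Y [a ax]] := loc_dense x e3.
have [V hV] := local_limit a T e3.
have approx U t : nrm (dyn (ham U) t x - dyn (ham U) t (loc iota a)) <= e / 3.
  rewrite -scaleN1r -dyn_scale -dyn_add scaleN1r nrm_dyn ?dag_ham//; exact: ltW.
exists V => W VW t tT.
apply: (le_trans (nrm_tri (dyn (ham W) t (loc iota a)) _ _)).
have -> : e = e / 3 + (e / 3 + e / 3) by lra.
apply: lerD; first exact: approx.
apply: (le_trans (nrm_tri (dyn (ham V) t (loc iota a)) _ _)).
by apply: lerD; [exact: hV|rewrite nrmBC].
Qed.

(** The last clause speaks of all volumes containing some V0, not of the sequence defining the
    limit; this gives independence of the exhausting sequence. *)
Lemma limit_dyn_exhausting (V : nat -> {fset L}) : exhausting V ->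
  let H n : calg A := ham (V n) in
  [/\ automorphism_group (limit_dyn H : R -> A -> A),
      strongly_continuous (limit_dyn H : R -> A -> A)
    & forall x (T e : R), 0 < e -> exists V0, forall W, V0 `<=` W ->
        forall t, `|t| <= T -> nrm (dyn (ham W) t x - limit_dyn H t x) < e].
Proof.
move=> V_exh H.
have H_sa n : dag (H n) = H n by exact: dag_ham.
have H_cauchy x (T e : R) : 0 < e -> exists N, forall m n,
    (N <= m)%N -> (N <= n)%N -> forall t, `|t| <= T ->
    nrm (dyn (H m) t x - dyn (H n) t x) < e.
  move=> e0; have e3 : 0 < e / 3 by rewrite divr_gt0.
  have [V0 hV0] := global_limit x T e3.
  have [N hN] := exhausting_contains V_exh V0.
  exists N => m n Nm Nn t tT.
  apply: (le_lt_trans (nrm_tri (dyn (ham V0) t x) _ _)).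
  have h1 := hV0 _ (hN _ Nm) _ tT; have h2 := hV0 _ (hN _ Nn) _ tT.
  by rewrite nrmBC in h2; lra.
split; [exact: limit_dyn_automorphism_group|exact: limit_dyn_continuous|].
(* Three errors of at most e / 4 leave the total strictly below e. *)
move=> x T e e0; have e4 : 0 < e / 4 by rewrite divr_gt0.
have [V0 hV0] := global_limit x T e4.
have [N hN] := exhausting_contains V_exh V0.
have [M hM] := limit_dyn_uniform H_cauchy x T e4.
pose n := maxn N M.
exists V0 => W V0W t tT.
have h1 := hV0 _ V0W _ tT.
have h2 := hV0 _ (hN n (leq_maxl _ _)) _ tT.
have h3 := hM n (leq_maxr _ _) _ tT.
apply: (le_lt_trans (nrm_tri (dyn (ham V0) t x) _ _)).
have := nrm_tri (dyn (ham (V n)) t x) (dyn (ham V0) t x) (limit_dyn H t x).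
rewrite nrmBC in h2; lra.
Qed.

End ThermodynamicLimit.

(** * Bounds from the decay function and the interaction class *)

Section DecayBounds.
Local Open Scope fset_scope.
Local Open Scope ring_scope.
Context {R : realType} {L : metricType R} (dim : L -> nat).
Context {A : cstarAlgType R[i]}.
Variable iota : forall X : {fset L}, @observable R L dim X -> A.
Hypothesis A_quasilocal : quasilocal_algebra iota.
Variables (F : R -> R) (a : R) (Phi : interaction R dim).
Hypothesis F_decay : decay_function L F.
Hypothesis a_ge0 : 0 <= a.
Hypothesis Phi_class : interaction_class F a Phi.
Local Notation phi X := (loc iota (Phi X)).
Local Notation ham V := (hamiltonian iota Phi V : calg A).

Let g (y z : L) : R := F (mdist y z).

Lemma kernel_gt0 y z : 0 < g y z.
Proof. by apply: (decay_gt0 F_decay); exact: mdist_ge0. Qed.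

Lemma kernel_summable : exists2 M, 0 <= M &
  forall y (s : seq L), uniq s -> \sum_(z <- s) g y z <= M.
Proof.
have [M M0 hM] := ereal_sup_esum_bound (decay_summable F_decay).
by exists M => // y s us; exact: hM.
Qed.

Lemma kernel_convolution : exists2 C, 0 <= C &
  forall y z (s : seq L), uniq s -> \sum_(x <- s) g y x * g x z <= C * g y z.
Proof.
have [C C0 hC] := ereal_sup_esum_bound (decay_convolution F_decay).
exists C => // y z s us; rewrite -ler_pdivrMr ?kernel_gt0// mulr_suml.
exact: (hC (y, z)).
Qed.

(** As a >= 0 and distances are nonnegative, the exponential weight is at most 1, so the bound with
    F_a implies the one with F. *)
Lemma interaction_le_kernel : exists2 b, 0 <= b &
  forall y z (s : seq {fset L}), uniq s ->
    (forall X, X \in s -> y \in X /\ z \in X) ->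
    \sum_(X <- s) nrm (phi X) <= b * g y z.
Proof.
have [b b0 hb] := ereal_sup_esum_bound Phi_class.
exists b => // y z s us sX.
have w0 : 0 < weighted F a (mdist y z) by rewrite mulr_gt0 ?expR_gt0 ?kernel_gt0.
apply: (@le_trans _ _ (b * weighted F a (mdist y z))).
  rewrite -ler_pdivrMr// mulr_suml.
  under eq_bigr do rewrite (nrm_loc A_quasilocal).
  exact: (hb (y, z)).
rewrite ler_wpM2l// ler_piMl ?(ltW (kernel_gt0 _ _))//.
by rewrite -expR0 ler_expR mulNr oppr_le0 mulr_ge0 ?mdist_ge0.
Qed.

Lemma local_dynamics_cauchy (Y : {fset L}) (o : @observable R L dim Y) (T e : R) :
  0 < e -> exists V, forall W, V `<=` W -> forall t, `|t| <= T ->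
    nrm (dyn (ham W) t (loc iota o) - dyn (ham V) t (loc iota o)) <= e.
Proof.
move=> e0.
have [M M0 g_sum] := kernel_summable.
have [C C0 g_conv] := kernel_convolution.
have [b b0 phi_le] := interaction_le_kernel.
have g0 y z : 0 <= g y z by exact/ltW/kernel_gt0.
pose D := `|T| * nrm (loc iota o) + 1.
have D0 : 0 < D by rewrite ltr_wpDl// mulr_ge0 ?nrm_ge0.
have [V YV hV] := growth_small g0 b0 C0 M0 phi_le g_sum Y T (divr_gt0 e0 D0).
exists V => W VW t tT.
have tT' : `|t| <= `|T| := le_trans tT (ler_norm T).
have phi_le' (U : {fset L}) y z :
    \sum_(Z <- fpowerset U | (y \in Z) && (z \in Z)) nrm (phi Z) <= b * g y z.
  rewrite -big_filter; apply: phi_le; first by rewrite filter_uniq// fset_uniq.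
  by move=> X; rewrite mem_filter => /andP[/andP[]].
have g_conv' (U : {fset L}) y z : \sum_(x <- U) g y x * g x z <= C * g y z.
  by apply: g_conv; exact: fset_uniq.
apply: (le_trans
  (finite_volume_compare A_quasilocal g0 b0 C0 phi_le' g_conv' o t YV VW)).
have hG := hV W `|t| tT.
apply: (@le_trans _ _ (`|T| * (nrm (loc iota o) * (e / D)))).
  apply: ler_pM => //; last by rewrite ler_wpM2l ?nrm_ge0.
  rewrite mulr_ge0 ?nrm_ge0// sumr_ge0// => y _.
  by apply: growth_ge0 => // z; exact: boundary_ge0.
have -> : `|T| * (nrm (loc iota o) * (e / D)) =
  `|T| * nrm (loc iota o) * e / D by rewrite !mulrA.
by rewrite ler_pdivrMr// mulrC ler_wpM2l ?(ltW e0)// lerDl.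
Qed.

End DecayBounds.

Lemma compact_le (R : realType) (K : set R) : compact K ->
  exists T : R, forall t, K t -> `|t| <= T.
Proof.
move=> /compact_bounded[M [_ hM]]; exists (M + 1) => t Kt.
by apply: hM; rewrite ?ltrDl.
Qed.

Theorem theorem2p2 (R : realType) (L : metricType R)
    (dim : L -> nat) (dim_gt0 : forall x, (0 < dim x)%N)
    (A : cstarAlgType R[i])
    (iota : forall X : {fset L}, @observable R L dim X -> A)
    (A_quasilocal : quasilocal_algebra iota)
    (F : R -> R) (F_decay : decay_function L F)
    (a : R) (a_ge0 : 0 <= a)
    (Phi : interaction R dim) (Phi_class : interaction_class F a Phi) :
  exists tau : R -> A -> A,
    [/\ automorphism_group tau,
        strongly_continuous tau
      & forall V : nat -> {fset L}, exhausting V -> forall x : A,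
          (forall t : R,
             `|finite_volume_dynamics iota Phi (V n) t x - tau t x|
               @[n --> \oo] --> (0 : R[i]^o)) /\
          (forall K : set R, compact K -> forall e : R, 0 < e ->
             \forall n \near \oo, forall t : R, K t ->
               `|finite_volume_dynamics iota Phi (V n) t x - tau t x|
                 < e%:C%C)].
Proof.
have [[V0 V0_exh]|no_exh] := pselect (exists V : nat -> {fset L}, exhausting V);
  last first.
  (* Summability of [F] makes [L] countable, so this case does not arise; but
     the last clause is then vacuous, and there is no need to prove it. *)
  exists (fun=> id); split; last by move=> V hV; case: no_exh; exists V.
    split=> // t; split=> //; by exists id.
  by move=> x t; exact: cvg_cst.
(* The group is defined along one fixed exhausting sequence; [tau_lim] then applies to every other
   one. *)
have [tau_aut tau_cont tau_lim] := limit_dyn_exhausting A_quasilocal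
  (local_dynamics_cauchy A_quasilocal F_decay a_ge0 Phi_class) V0_exh.
set tau := limit_dyn _ in tau_aut tau_cont tau_lim.
exists tau; split => // V V_exh x.
(* This estimate gives both conclusions: the pointwise limit with T = |t|, and uniformity on K with
   T a bound for K. *)
have unif (T e : R) : 0 < e -> exists N, forall n, (N <= n)%N ->
    forall t, `|t| <= T ->
      `|finite_volume_dynamics iota Phi (V n) t x - tau t x| < e%:C%C.
  move=> /(tau_lim x T)[U hU].
  have [N hN] := exhausting_contains V_exh U.
  exists N => n /hN Un t tT.
  rewrite (nrmE (dyn (hamiltonian iota Phi (V n)) t x - tau t x : calg A)) ltcR.
  exact: hU.
split.
  move=> t; apply/cvgrPdist_lt => e /Re_gt0[e0 ->].
  have [N hN] := unif `|t| _ e0; exists N => // n Nn.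
  by rewrite /= sub0r normrN normr_id hN.
move=> K /compact_le[T hT] e e0.
have [N hN] := unif T _ e0; exists N => // n Nn t /hT; exact: hN.
Qed.
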